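(* Let $\mathcal D\subseteq\mathbb{R}^d$ be open and convex, let $K\in\mathbb{Z}_{\ge2}$, and let $\{L^{(n)}\}_{n\ge0}$ be loss functions $L^{(n)}:\mathcal D\to\mathbb{R}$ that are $2K$ times continuously differentiable with all derivatives of order up to $2K$ bounded on $\mathcal D$ uniformly in $n$. Let $(\theta^{(n)})_{n\ge0}\subset\mathcal D$ be the mini-batch HB iteration and $(\tilde\theta^{(n)})_{n\ge0}\subset\mathcal D$ the order-$K$ memoryless iteration, both started at the same $\theta^{(0)}=\tilde\theta^{(0)}\in\mathcal D$. Let $T>0$. Then there are constants $C_1,C_2$ (depending on $T$, $K$, $\beta$ and the derivative bounds, but not on $h$ or $n$) such that for every $h\in(0,1/2)$ $$\sup_{n\in[0,\lfloor T/h\rfloor]}\Big\|\tilde\theta^{(n+1)}-\tilde\theta^{(n)}+h\sum_{k=0}^n\beta^k\nabla L^{(n-k)}(\tilde\theta^{(n-k)})\Big\|\le C_1h^{K+1}$$ and $$\sup_{n\in[0,\lfloor T/h\rfloor]}\|\theta^{(n)}-\tilde\theta^{(n)}\|\le C_2h^{K}.$$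
   Context: Fix $\beta\in(0,1)$, $h>0$. $[a,b]$ denotes $[a,b]\cap\mathbb{Z}$; empty sums are $0$. For a sufficiently smooth map $F$, $\nabla^kF(\theta)$ is its $k$-th derivative (a symmetric $k$-linear map, vector-valued if $F$ is vector-valued), $\nabla^0F=F$, and $\nabla^kF(\theta)[u_1^{\times r_1},\dots,u_q^{\times r_q}]$ means evaluation with $u_1$ repeated $r_1$ times, etc. For integers $i,l\ge0$, $\mathcal K_{i,l}:=\{(k_0,\dots,k_l)\in\mathbb{Z}_{\ge0}^{l+1}:\ k_0+\dots+k_l=i,\ \sum_{j=1}^l jk_j=l\}$. Mini-batch HB: $\theta^{(n+1)}=\theta^{(n)}-h\sum_{k=0}^n\beta^k\nabla L^{(n-k)}(\theta^{(n-k)})$. Memoryless iteration coefficients $c_m^{(n)}:\mathcal D\to\mathbb{R}^d$ and history terms $p_m^{(n,a)}:\mathcal D\to\mathbb{R}^d$ ($n\ge0$, $m\ge1$, $a\in[1,n]$) are defined recursively by $c_1^{(n)}(\theta)=-\sum_{k=0}^n\beta^k\nabla L^{(n-k)}(\theta)$, $$c_m^{(n)}(\theta)=-\sum_{k=1}^n\beta^k\sum_{\substack{i,l\ge0\\ i+l=m-1}}\sum_{(i_0,\dots,i_l)\in\mathcal K_{i,l}}\frac{1}{i_0!\cdots i_l!}\nabla^{i+1}L^{(n-k)}(\theta)\big[p_1^{(n,k)}(\theta)^{\times i_0},\dots,p_{l+1}^{(n,k)}(\theta)^{\times i_l}\big],\ m\ge2,$$ $$p_m^{(n,a)}(\theta)=-\sum_{s=1}^a\sum_{\substack{j\ge1,\,i,l\ge0\\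 i+j+l=m}}\sum_{(k_0,\dots,k_l)\in\mathcal K_{i,l}}\frac{1}{k_0!\cdots k_l!}\nabla^{i}c_j^{(n-s)}(\theta)\big[p_1^{(n,s)}(\theta)^{\times k_0},\dots,p_{l+1}^{(n,s)}(\theta)^{\times k_l}\big]$$ (only $p_{j}$ with $j<m$ and $c_j$ with $j\le m$ appear with nonzero multiplicity, so the recursion is well defined). The order-$K$ memoryless iteration is $\tilde\theta^{(n+1)}=\tilde\theta^{(n)}+\sum_{j=1}^Kh^jc_j^{(n)}(\tilde\theta^{(n)})$. *)

(* Defs.v *)
From HB Require Import structures.
From mathcomp Require Import all_boot all_order all_algebra.
From mathcomp Require Import all_classical all_reals all_analysis.
Set Implicit Arguments. Unset Strict Implicit. Unset Printing Implicit Defensive.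
Import Order.TTheory GRing.Theory Num.Theory.
Import numFieldNormedType.Exports.
Local Open Scope classical_set_scope.
Local Open Scope ring_scope.

Section Defs.
Variable R : realType.

(** Iterated directional derivative:
    [dern F [:: u1; ...; uk] x] = D_{u1} (D_{u2} ( ... (D_{uk} F))) (x),
    i.e. the k-th derivative  nabla^k F(x)[u1,...,uk]  of a (sufficiently
    smooth) map F, written out via directional derivatives. *)
Fixpoint dern (V W : normedModType R) (F : V -> W) (us : seq V) : V -> W :=
  match us with
  | [::] => F
  | u :: us' => fun x => derive (dern F us') x u
  end.

Definition Ck_on (V W : normedModType R) (k : nat) (D : set V) (F : V -> W) :=
  (forall us : seq V, (size us < k)%N -> forall x, D x ->
      differentiable (dern F us) x) /\
  (forall us : seq V, size us = k -> forall x, D x ->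
      {for x, continuous (dern F us)}).

(** all derivatives of F of order 0..k are bounded by M on D
    (operator-norm bound on the multilinear map nabla^j F(x)). *)
Definition derivs_bounded_on (V W : normedModType R) (k : nat) (D : set V)
    (F : V -> W) (M : R) :=
  forall us : seq V, (size us <= k)%N -> forall x, D x ->
    `|dern F us x| <= M * \prod_(u <- us) `|u|.

Variable d : nat.
Local Notation V := 'rV[R]_d.

Definition grad (f : V -> R) (x : V) : V :=
  \row_(j < d) derive f x (delta_mx 0 j).

(** Sum over the multi-index set K_{i,l}: tuples (k_0,...,k_l) of naturals with
    k_0+...+k_l = i and sum_j j*k_j = l (each k_j <= i, so ranging over
    {ffun 'I_l.+1 -> 'I_i.+1} is exhaustive).  The summand is
    1/(k_0!...k_l!) nabla^i G(x)[q_0^{x k_0}, ..., q_l^{x k_l}] where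
    q_j = qs j. *)
Definition Ksum (G : V -> V) (qs : nat -> V) (i l : nat) (x : V) : V :=
  \sum_(k : {ffun 'I_l.+1 -> 'I_i.+1} |
          ((\sum_(j < l.+1) (k j : nat))%N == i) &&
          ((\sum_(j < l.+1) (j * k j)%N)%N == l))
     ((\prod_(j < l.+1) ((k j : nat)`!)%:R)^-1 : R) *:
        dern G (flatten [seq nseq (k j) (qs (j : nat)) | j <- enum 'I_l.+1]) x.

Variables (beta : R) (L : nat -> V -> R).

Definition cfun := nat -> V -> V.
Definition pfun := nat -> nat -> V -> V.

Definition c_one : cfun := fun n x =>
  - \sum_(k < n.+1) beta ^+ k *: grad (L (n - k)%N) x.

(** c_m from the list ps = [p_1; ...; p_{m-1}]  (m >= 2). *)
Definition c_step (m : nat) (ps : seq pfun) : cfun := fun n x =>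
  - \sum_(1 <= k < n.+1) beta ^+ k *:
      \sum_(i < m) Ksum (grad (L (n - k)%N))
          (fun j => nth (fun _ _ _ => 0) ps j n k x) i (m.-1 - i)%N x.

(** p_m from cs = [c_1; ...; c_m] and ps = [p_1; ...; p_{m-1}]. *)
Definition p_step (m : nat) (cs : seq cfun) (ps : seq pfun) : pfun :=
  fun n a x =>
  - \sum_(1 <= s < a.+1) \sum_(1 <= j < m.+1) \sum_(i < (m - j)%N.+1)
      Ksum (nth (fun _ _ => 0) cs j.-1 (n - s)%N)
          (fun j' => nth (fun _ _ _ => 0) ps j' n s x) i (m - j - i)%N x.

Fixpoint levels (m : nat) : seq (cfun * pfun) :=
  match m with
  | 0 => [::]
  | m'.+1 =>
      let prev := levels m' in
      let cs := map fst prev in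
      let ps := map snd prev in
      let cm := if m' is 0 then c_one else c_step m'.+1 ps in
      rcons prev (cm, p_step m'.+1 (rcons cs cm) ps)
  end.

Definition coef (m n : nat) : V -> V :=
  (nth ((fun _ _ => 0), (fun _ _ _ => 0)) (levels m) m.-1).1 n.
Definition hist (m n a : nat) : V -> V :=
  (nth ((fun _ _ => 0), (fun _ _ _ => 0)) (levels m) m.-1).2 n a.

Definition is_HB (h : R) (th : nat -> V) :=
  forall n, th n.+1 = th n - h *: \sum_(k < n.+1) beta ^+ k *: grad (L (n - k)%N) (th (n - k)%N).

Definition is_memoryless (K : nat) (h : R) (tt : nat -> V) :=
  forall n, tt n.+1 = tt n + \sum_(1 <= j < K.+1) h ^+ j *: coef j n (tt n).

End Defs.

(* Main.v *)
Require Import Defs.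
From HB Require Import structures.
From mathcomp Require Import all_boot all_order all_algebra.
From mathcomp Require Import all_classical all_reals all_analysis.
From mathcomp Require Import ring lra zify.
Set Implicit Arguments. Unset Strict Implicit. Unset Printing Implicit Defensive.
Import Order.TTheory GRing.Theory Num.Theory.
Import numFieldNormedType.Exports.
Local Open Scope classical_set_scope.
Local Open Scope ring_scope.

(** All estimates are made in the class [bsmooth k D f C] of scalar functions
    with derivatives up to order [k] bounded by [C] on [D], uniformly in the
    losses and up to a polynomial weight in the age [a] of the history.

    Going back [a] steps, [tt (n - a)] has an expansion in powers of [h] around
    [tt n] with coefficients [hist m n a (tt n)].  This follows by induction on
    the order: [tt (n - a) - tt n] is a sum of increments evaluated at
    [tt (n - s)], and a Taylor expansion at [tt n] along the expansion of lower
    order regroups, by the multinomial theorem for iterated derivatives, into the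
    sums over [K_{i,l}] defining [hist].  The truncated expansion may leave [D],
    so the Taylor formula is only used on the segment from [tt n] to
    [tt (n - a)]; the multinomial theorem is then a pointwise identity at [tt n].
    The same expansion of the gradients shows that the coefficients [coef] cancel
    the defect of the memoryless iteration in the heavy-ball recursion up to
    [h ^+ K.+1]; the factors [beta ^+ k] absorb the polynomial weights.  A discrete
    Gronwall argument over [T / h] steps gives the global error. *)

(** * Transfer of differentiability, and the max norm on matrices *)

Section Differentiability.
Variable R : realType.

(** The differential of [f] is also a first-order expansion of [g] at [x], and uniqueness of
    differentials then identifies it with that of [g]. *)
Lemma near_eq_differentiable (V W : normedModType R) (f g : V -> W) (x : V) :
  {near x, f =1 g} -> differentiable f x -> differentiable g x.
Proof.
move=> fg df.
have gx : g \o shift x = cst (g x) + 'd f x +o_ (0 : V) id.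
  apply/eqaddoP => e e0.
  have /diff_locallyP[_ /eqaddoP/(_ e e0)] := df.
  have := fg; rewrite -[nbhs x]/(nbhs (x : V)) (near_shift 0) subr0 => fg0 fo.
  near=> h.
  have <- : (f \o shift x - (cst (f x) + 'd f x)) h
          = (g \o shift x - (cst (g x) + 'd f x)) h.
    rewrite !fctE /= (nbhs_singleton fg); congr (_ - _).
    by have := near fg0 h; apply.
  by near: h.
have dg := diff_unique (@diff_continuous _ _ _ _ _ df) gx.
by apply/diff_locallyP; rewrite dg; split => //; exact: diff_continuous.
Unshelve. all: by end_near. Qed.

Lemma mx_norm_le (m n : nat) (A : 'M[R]_(m, n)) (C : R) :
  0 <= C -> (forall i j, `|A i j| <= C) -> `|A| <= C.
Proof.
move=> C0 AC; rewrite /Num.Def.normr/= mx_normrE.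
by apply: bigmax_le => // -[i j] _ /=.
Qed.

Lemma mx_norm_ge (m n : nat) (A : 'M[R]_(m, n)) i j : `|A i j| <= `|A|.
Proof.
rewrite [leRHS]/Num.Def.normr/= mx_normrE.
exact: (le_bigmax _ (fun p : 'I_m * 'I_n => `|A p.1 p.2|) (i, j)).
Qed.

Lemma mx_norm_delta_le1 (m n : nat) (i : 'I_m) (j : 'I_n) :
  `|delta_mx i j : 'M[R]_(m, n)| <= 1.
Proof.
apply: mx_norm_le => // i' j'; rewrite mxE.
by case: (_ && _); rewrite ?normr1 ?normr0.
Qed.

End Differentiability.

(** * Scalar functions with bounded partial derivatives *)

Section BoundedSmooth.
Variables (R : realType) (d : nat).
Local Notation V := 'rV[R]_d.
Implicit Types (D : set V) (f g : V -> R) (x v : V) (C : R) (us : seq V).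

Definition pd (j : 'I_d) (f : V -> R) : V -> R :=
  fun x => derive f x (delta_mx 0 j).

(* No continuity is asked of the derivatives of top order [k]: their bound
   already controls every Taylor remainder. *)
Fixpoint bsmooth (k : nat) D f C : Prop :=
  (forall x, D x -> `|f x| <= C) /\
  match k with
  | 0 => True
  | k'.+1 => (forall x, D x -> differentiable f x) /\
             forall j, bsmooth k' D (pd j f) C
  end.

Lemma bsmooth_bound k D f C x : bsmooth k D f C -> D x -> `|f x| <= C.
Proof. by case: k => [|k] [H _] Dx; exact: H. Qed.

Lemma bsmooth_diff k D f C x : bsmooth k.+1 D f C -> D x -> differentiable f x.
Proof. by case=> _ [H _] Dx; exact: H. Qed.

Lemma bsmooth_pd k D f C j : bsmooth k.+1 D f C -> bsmooth k D (pd j f) C.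
Proof. by case=> _ [_ H]; exact: H. Qed.

Lemma bsmooth_le k k' D f C C' :
  (k' <= k)%N -> C <= C' -> bsmooth k D f C -> bsmooth k' D f C'.
Proof.
move=> + CC; elim: k' k f => [|k' IH] [|k] f //= kk.
- by case=> H _; split => // x /H xC; exact: le_trans CC.
- by case=> H _; split => // x /H xC; exact: le_trans CC.
- case=> H [df dj]; split; first by move=> x /H xC; exact: le_trans CC.
  by split => // j; exact: IH (dj j).
Qed.

Lemma open_near_eq (T : Type) D (f g : V -> T) x :
  open D -> (forall y, D y -> f y = g y) -> D x -> {near x, f =1 g}.
Proof.
move=> oD fg Dx; have := open_nbhs_nbhs (conj oD Dx).
exact: filterS.
Qed.

Lemma eq_bsmooth k D f g C :
  open D -> (forall y, D y -> f y = g y) -> bsmooth k D f C -> bsmooth k D g C.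
Proof.
move=> oD; elim: k f g => [|k IH] f g fg /=.
  by case=> H _; split => // x Dx; rewrite -fg//; exact: H.
case=> H [df dj]; split; first by move=> x Dx; rewrite -fg//; exact: H.
split=> [x Dx|j].
  by apply: (near_eq_differentiable (open_near_eq oD fg Dx)); exact: df.
apply: IH (dj j) => y Dy.
exact: (near_eq_derive _ (open_near_eq oD fg Dy)).
Qed.

Lemma bsmooth_cst k D (c : R) : bsmooth k D (fun=> c) `|c|.
Proof.
(* The bound is freed from [c], because the derivative is the constant 0 and must be bounded by the
   same [C]. *)
suff H C : `|c| <= C -> bsmooth k D (fun=> c) C by exact: H.
elim: k c => [|k IH] c cC /=; first by split.
split => //; split => [x Dx|j]; first exact: differentiable_cst.
have -> : pd j (fun=> c) = (fun=> 0).
  by apply/funext => x; exact: derive_cst.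
by apply: IH; rewrite normr0 (le_trans _ cC).
Qed.

Lemma bsmoothD k D f g C C' : open D ->
  bsmooth k D f C -> bsmooth k D g C' -> bsmooth k D (fun x => f x + g x) (C + C').
Proof.
move=> oD; elim: k f g => [|k IH] f g bf bg.
  split => // x Dx; rewrite (le_trans (ler_normD _ _))//.
  by rewrite lerD// ?(bsmooth_bound bf)// (bsmooth_bound bg).
split.
  move=> x Dx; rewrite (le_trans (ler_normD _ _))//.
  by rewrite lerD// ?(bsmooth_bound bf)// (bsmooth_bound bg).
split=> [x Dx|j].
  by apply: differentiableD; [exact: (bsmooth_diff bf)|exact: (bsmooth_diff bg)].
apply: (eq_bsmooth oD _ (IH _ _ (bsmooth_pd j bf) (bsmooth_pd j bg))) => y Dy.
rewrite /pd -deriveD//; apply: diff_derivable; first exact: (bsmooth_diff bf).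
exact: (bsmooth_diff bg).
Qed.

(** By the Leibniz rule each differentiation turns a product into two, so the bound doubles with
    every order. *)
Lemma bsmoothM k D f g C C' : open D -> 0 <= C -> 0 <= C' ->
  bsmooth k D f C -> bsmooth k D g C' ->
  bsmooth k D (fun x => f x * g x) (2 ^+ k * (C * C')).
Proof.
move=> oD C0 C'0; elim: k f g => [|k IH] f g bf bg.
  split => // x Dx; rewrite expr0 mul1r normrM.
  by rewrite ler_pM// ?(bsmooth_bound bf)// (bsmooth_bound bg).
split.
  move=> x Dx; rewrite normrM (@le_trans _ _ (C * C'))//.
    by rewrite ler_pM// ?(bsmooth_bound bf)// (bsmooth_bound bg).
  by rewrite ler_peMl ?mulr_ge0// exprn_ege1// ler1n.
split=> [x Dx|j].
  by apply: differentiableM; [exact: (bsmooth_diff bf)|exact: (bsmooth_diff bg)].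
have bf' := bsmooth_le (leqnSn k) (lexx C) bf.
have bg' := bsmooth_le (leqnSn k) (lexx C') bg.
have := bsmoothD oD (IH _ _ bf' (bsmooth_pd j bg)) (IH _ _ (bsmooth_pd j bf) bg').
rewrite -mulr2n -[_ *+ 2]mulr_natl mulrA -exprS => /(eq_bsmooth oD); apply => y Dy.
rewrite /pd deriveM/=; first by rewrite addrC/= /GRing.scale/= addrC [_ * g y]mulrC.
  exact/diff_derivable/(bsmooth_diff bf).
exact/diff_derivable/(bsmooth_diff bg).
Qed.

Lemma bsmoothZ k D f C (c : R) : open D ->
  bsmooth k D f C -> bsmooth k D (fun x => c * f x) (`|c| * C).
Proof.
move=> oD; elim: k f => [|k IH] f bf.
  by split => // x Dx; rewrite normrM ler_wpM2l// (bsmooth_bound bf).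
split; first by move=> x Dx; rewrite normrM ler_wpM2l// (bsmooth_bound bf).
split=> [x Dx|j].
  apply: (@differentiableZ _ _ _ f c); exact: (bsmooth_diff bf).
apply: (eq_bsmooth oD _ (IH _ (bsmooth_pd j bf))) => y Dy.
rewrite /pd (deriveZ c)//; exact/diff_derivable/(bsmooth_diff bf).
Qed.

Lemma bsmooth_sum (I : Type) (r : seq I) (P : pred I) k D (F : I -> V -> R)
    (C : I -> R) : open D ->
  (forall i, P i -> bsmooth k D (F i) (C i)) ->
  bsmooth k D (fun x => \sum_(i <- r | P i) F i x) (\sum_(i <- r | P i) C i).
Proof.
move=> oD bF; elim: r => [|i r IH].
  rewrite big_nil; under eq_fun do rewrite big_nil.
  by have := bsmooth_cst k D 0; rewrite normr0.
rewrite big_cons; under eq_fun do rewrite big_cons.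
by case: ifP => // Pi; exact: bsmoothD (bF _ Pi) IH.
Qed.

Lemma derive_pd_sum f x v : differentiable f x ->
  derive f x v = \sum_j v 0 j * pd j f x.
Proof.
move=> df; rewrite deriveE// [in LHS](row_sum_delta v) linear_sum/=.
by apply: eq_bigr => j _; rewrite linearZ/= /pd deriveE.
Qed.

(** The direction splits into [d] coordinates, each at most [|v|] in the max norm; this is the
    source of the factor [d%:R] in all later bounds. *)
Lemma bsmooth_derive k D f C v : open D -> bsmooth k.+1 D f C -> 0 <= C ->
  bsmooth k D (fun x => derive f x v) (C * (d%:R * `|v|)).
Proof.
move=> oD bf C0.
have := @bsmooth_sum _ (index_enum 'I_d) xpredT k D _ _ oD
  (fun j _ => bsmoothZ (v 0 j) oD (bsmooth_pd j bf)).
move/(eq_bsmooth oD (g := fun x => derive f x v)) => /(_ _)/bsmooth_le; apply => //.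
  rewrite -mulr_suml mulrC ler_wpM2l//.
  apply: (@le_trans _ _ (\sum_(j < d) `|v|)).
    by apply: ler_sum => j _; exact: mx_norm_ge.
  by rewrite sumr_const card_ord mulr_natl.
by move=> y Dy; rewrite derive_pd_sum//; exact: (bsmooth_diff bf).
Qed.

End BoundedSmooth.

(** * Linearity and homogeneity of iterated directional derivatives *)

Section IteratedDerivatives.
Variables (R : realType) (d : nat).
Local Notation V := 'rV[R]_d.
Implicit Types (D : set V) (f g : V -> R) (x v : V) (C : R) (us : seq V).

(** The last direction is differentiated first. Inductions on direction lists peel it off, since
    this replaces the function by one that is again [bsmooth], of one order less. *)
Lemma dern_rcons (W : normedModType R) (F : V -> W) us v :
  dern F (rcons us v) = dern (fun x => derive F x v) us.
Proof. by elim: us => //= u us ->. Qed.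

Lemma dern_cat (W : normedModType R) (F : V -> W) us vs :
  dern F (us ++ vs) = dern (dern F vs) us.
Proof. by elim: us => //= u us ->. Qed.

Lemma nseqSr (T : Type) (n : nat) (a : T) : nseq n.+1 a = rcons (nseq n a) a.
Proof. by elim: n => //= n <-. Qed.

Lemma dern_nseqS (W : normedModType R) (F : V -> W) n v :
  dern F (nseq n.+1 v) = dern (fun x => derive F x v) (nseq n v).
Proof. by rewrite nseqSr dern_rcons. Qed.

Lemma eq_dern (W : normedModType R) D (F G : V -> W) us x : open D ->
  (forall y, D y -> F y = G y) -> D x -> dern F us x = dern G us x.
Proof.
move=> oD FG; elim: us x => [|u us IH] x Dx /=; first exact: FG.
exact: (near_eq_derive _ (open_near_eq oD IH Dx)).
Qed.

Lemma bsmooth_dern k D f C us : open D -> 0 <= C ->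
  bsmooth (k + size us) D f C ->
  bsmooth k D (dern f us) (C * \prod_(u <- us) (d%:R * `|u|)).
Proof.
move=> oD; elim/last_ind: us f C => [|us u IH] f C C0.
  by rewrite big_nil mulr1 addn0.
rewrite size_rcons addnS => bf; rewrite dern_rcons.
rewrite -cats1 big_cat big_seq1 [X in C * X]mulrC mulrA.
apply: IH; first by rewrite !mulr_ge0.
exact: bsmooth_derive.
Qed.

Lemma dern_sum (I : Type) (r : seq I) (F : I -> V -> R) (c : I -> R) C D us x :
  open D -> 0 <= C -> (forall i, bsmooth (size us) D (F i) C) -> D x ->
  dern (fun y => \sum_(i <- r) c i * F i y) us x
  = \sum_(i <- r) c i * dern (F i) us x.
Proof.
move=> oD; elim/last_ind: us F C => [|us u IH] F C C0 bF Dx //.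
rewrite size_rcons in bF; rewrite dern_rcons.
rewrite (@eq_dern _ D _ (fun y => \sum_(i <- r) c i * derive (F i) y u))//.
  rewrite (IH _ (C * (d%:R * `|u|)))//.
  - by apply: eq_bigr => i _; rewrite dern_rcons.
  - by rewrite !mulr_ge0.
  - by move=> i; exact: bsmooth_derive.
move=> y Dy; elim: r {IH} => [|i r IHr].
  by under eq_fun do rewrite big_nil; rewrite big_nil; exact: derive_cst.
under eq_fun do rewrite big_cons.
rewrite big_cons -IHr.
have di j : differentiable (F j) y by exact: (bsmooth_diff (bF j)).
rewrite (@deriveD _ _ _ (fun y => c i * F i y)); last 2 first.
- by apply: (@derivableZ _ _ _ (F i) (c i)); exact/diff_derivable.
- apply: diff_derivable.
  have /bsmooth_diff : bsmooth 1 D (fun z => \sum_(j <- r) c j * F j z)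
      (\sum_(j <- r) `|c j| * C).
    apply: bsmooth_sum => // j _; apply: bsmoothZ => //.
    exact: bsmooth_le (bF j).
  exact.
by congr (_ + _); rewrite (deriveZ (c i))//; exact/diff_derivable.
Qed.

Lemma dernZ (c : R) f C D us x : open D -> 0 <= C ->
  bsmooth (size us) D f C -> D x ->
  dern (fun y => c * f y) us x = c * dern f us x.
Proof.
move=> oD C0 bf Dx.
have := @dern_sum _ [:: tt] (fun=> f) (fun=> c) C D us x oD C0 (fun=> bf) Dx.
by rewrite big_seq1 => <-; congr dern; apply/funext => y; rewrite big_seq1.
Qed.

Lemma derive_scale (c : R) f x v : differentiable f x ->
  derive f x (c *: v) = c * derive f x v.
Proof. by move=> df; rewrite !deriveE// linearZ. Qed.

Lemma dern_nseqZ (c : R) f C D n v x : open D -> 0 <= C ->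
  bsmooth n D f C -> D x ->
  dern f (nseq n (c *: v)) x = c ^+ n * dern f (nseq n v) x.
Proof.
move=> oD; elim: n f C => [|n IH] f C C0 bf Dx; first by rewrite mul1r.
rewrite !dern_nseqS (@eq_dern _ D _ (fun y => c * derive f y v))//; last first.
  by move=> y Dy; rewrite derive_scale//; exact: (bsmooth_diff bf).
have bfv := bsmooth_derive v oD bf C0.
have C0' : 0 <= C * (d%:R * `|v|) by rewrite !mulr_ge0.
rewrite (@dernZ _ _ (C * (d%:R * `|v|)) D)// ?size_nseq//.
by rewrite (IH _ _ C0')// mulrA exprS.
Qed.

Lemma dern_rcons_sum f C D us v x : open D -> 0 <= C ->
  bsmooth (size us).+1 D f C -> D x ->
  dern f (rcons us v) x = \sum_j v 0 j * dern (pd j f) us x.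
Proof.
move=> oD C0 bf Dx; rewrite dern_rcons.
rewrite (@eq_dern _ D _ (fun y => \sum_j v 0 j * pd j f y))//; last first.
  by move=> y Dy; rewrite derive_pd_sum//; exact: (bsmooth_diff bf).
by rewrite (@dern_sum _ _ _ _ C D)// => j; exact: bsmooth_pd.
Qed.

(** This reduces all estimates on vector-valued maps to their scalar coordinates. *)
Lemma dern_coord (G : V -> V) (C : R) D us x j : open D -> 0 <= C ->
  (forall j, bsmooth (size us) D (fun y => G y 0 j) C) -> D x ->
  dern G us x 0 j = dern (fun y => G y 0 j) us x.
Proof.
move=> oD; elim/last_ind: us G C => [|us u IH] G C C0 bG Dx //.
rewrite size_rcons in bG; rewrite !dern_rcons.
have dGj y i : D y -> derive G y u 0 i = derive (fun z => G z 0 i) y u.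
  move=> Dy; rewrite derive_mx ?mxE//; apply/derivable_mxP => k l.
  by apply: diff_derivable; rewrite (ord1 k); exact: (bsmooth_diff (bG l)).
rewrite (IH _ (C * (d%:R * `|u|)))//.
- by apply: eq_dern oD _ Dx => y Dy; exact: dGj.
- by rewrite !mulr_ge0.
- move=> i; apply: (eq_bsmooth oD _ (bsmooth_derive u oD (bG i) C0)) => y Dy.
  by rewrite dGj.
Qed.

End IteratedDerivatives.

(** * Taylor's formula on a segment and the binomial formula for derivatives *)

Section Taylor.
Variables (R : realType) (d : nat).
Local Notation V := 'rV[R]_d.
Implicit Types (D : set V) (f g : V -> R) (x u v : V) (C : R).

Definition tpoly (n : nat) f v x : {poly R} :=
  \poly_(i < n) (dern f (nseq i v) x / i`!%:R).

Lemma deriv_tpoly n f v x :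
  (tpoly n.+1 f v x)^`() = tpoly n (fun y => derive f y v) v x.
Proof.
apply/polyP => i; rewrite coef_deriv !coef_poly ltnS; case: ifP => // _.
  rewrite -dern_nseqS -[LHS]mulr_natr factS natrM invfM -mulrA.
  by congr (_ * _); rewrite mulrC mulVKf// pnatr_eq0.
by rewrite mul0rn.
Qed.

Lemma is_derive_line f x v (s : R) : differentiable f (x + s *: v) ->
  is_derive s 1 (fun t : R => f (x + t *: v)) (derive f (x + s *: v) v).
Proof.
move=> df.
have dl : is_diff s (fun t : R => x + t *: v) ( *:%R^~ v).
  have := @is_diffD R R V (cst x) (fun t : R => t *: v) 0 (fun t : R => t *: v)
    s (is_diff_cst x s) (is_diff_scalel s v).
  by rewrite add0r.
have dc : is_diff (x + s *: v) f ('d f (x + s *: v)) by split.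
have [Df Dv] := is_diff_comp dl dc.
split; first exact: diff_derivable.
by rewrite deriveE// Dv /= scale1r -deriveE.
Qed.

(** By [deriv_tpoly], the derivative in [t] of the remainder is the remainder, of one order less, of
    the directional derivative of [f]. The mean value theorem on [[0, t]] then closes an induction
    that stays on the segment. *)
Lemma taylor_bound n f C D x v (t : R) : open D -> 0 <= C -> 0 <= t ->
  bsmooth n D f C -> (forall s : R, 0 <= s <= t -> D (x + s *: v)) ->
  `|f (x + t *: v) - (tpoly n f v x).[t]| <= C * (d%:R * `|v| * t) ^+ n.
Proof.
move=> oD; elim: n f C t => [|n IH] f C t C0 t0 bf Dseg.
  rewrite mulr1 /tpoly poly_def big_ord0 horner0 subr0.
  by apply: (bsmooth_bound bf); apply: Dseg; rewrite t0 lexx.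
pose g s := f (x + s *: v) - (tpoly n.+1 f v x).[s].
pose dg s := derive f (x + s *: v) v -
             (tpoly n (fun y => derive f y v) v x).[s].
have dgE s : 0 <= s <= t -> is_derive s 1 g (dg s).
  move=> /Dseg Ds; rewrite /dg -deriv_tpoly.
  apply: is_deriveB; apply: is_derive_line.
  exact: (bsmooth_diff bf).
have [c cab] : exists2 c, c \in `[0, t]%R & g t - g 0 = dg c * (t - 0).
  apply: MVT_segment => //.
    by move=> s; rewrite in_itv/= => /andP[s0 st]; apply: dgE; rewrite !ltW.
  apply: derivable_within_continuous => s; rewrite in_itv/= => s0t.
  by have [] := dgE _ s0t.
have -> : g 0 = 0.
  rewrite /g scale0r addr0 horner_coef0 coef_poly/= fact0 divr1.
  exact: subrr.
rewrite !subr0 -/(g t) => ->; rewrite normrM (ger0_norm t0).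
move: cab; rewrite in_itv/= => /andP[c0 ct].
have K0 : 0 <= d%:R * `|v| :> R by rewrite mulr_ge0.
have /le_trans -> // : `|dg c| * t <= C * (d%:R * `|v|) * (d%:R * `|v| * c) ^+ n * t.
  rewrite ler_wpM2r//; apply: IH => //; first by rewrite mulr_ge0.
    exact: bsmooth_derive.
  by move=> s /andP[s0 sc]; apply: Dseg; rewrite s0 (le_trans sc).
rewrite exprS [_ * t]mulrAC -!mulrA ler_wpM2l// !mulrA ler_wpM2l//.
  by rewrite mulr_ge0.
by rewrite lerXn2r// ?nnegrE ?mulr_ge0// ler_wpM2l.
Qed.

(** The constant coefficient is [O(t)], hence 0; dividing by the variable lowers both the size and
    the order of vanishing. *)
Lemma poly_eq0_littleo (p : {poly R}) (n : nat) (C e : R) : 0 < e ->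
  (size p <= n)%N -> (forall t : R, 0 < t < e -> `|p.[t]| <= C * t ^+ n) -> p = 0.
Proof.
move=> e0; elim: n p => [|n IH] p; first by rewrite leqn0 size_poly_eq0 => /eqP.
elim/poly_ind: p => [//|p c _] szp pC.
have [B Bp] := poly_disk_bound p e.
have B0 : 0 <= B by rewrite (le_trans _ (Bp 0 _))// normr0 ltW.
have te (t : R) : 0 < t < e -> `|c| <= (B + `|C| * e ^+ n) * t.
  move=> /andP[t0 tle].
  have := pC t; rewrite t0 tle => /(_ isT); rewrite !hornerE => H.
  have -> : c = (p.[t] * t + c) - p.[t] * t by rewrite addrAC subrr add0r.
  rewrite (le_trans (ler_normB _ _))// addrC mulrDl lerD//.
    by rewrite normrM (gtr0_norm t0) ler_wpM2r ?(ltW t0)// Bp// gtr0_norm// ltW.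
  rewrite (le_trans H)// exprS mulrCA mulrC.
  rewrite ler_wpM2r ?(ltW t0)// (le_trans (ler_norm _))// normrM ler_wpM2l//.
  rewrite ger0_norm ?exprn_ge0 ?(ltW t0)//.
  by rewrite lerXn2r ?nnegrE ?(ltW t0) ?(ltW e0) ?(ltW tle).
have c0 : c = 0.
  apply/normr0_eq0/eqP; rewrite eq_le normr_ge0 andbT.
  set K := B + _ in te.
  have K0 : 0 <= K by rewrite addr_ge0// mulr_ge0// exprn_ge0// ltW.
  apply/ler_addgt0Pr => z z0; rewrite add0r.
  (* Small enough for [K * t <= z], and inside the interval where the bound is available. *)
  pose t := Num.min (e / 2) (z / (K + 1)).
  have t0 : 0 < t by rewrite lt_min !divr_gt0// ltr_wpDl.
  have tle : t < e.
    by rewrite gt_min ltr_pdivrMr// ltr_pMr// ltr1n.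
  rewrite (le_trans (te t _)) ?t0//.
  have : t <= z / (K + 1) by rewrite ge_min lexx orbT.
  rewrite ler_pdivlMr ?ltr_wpDl// => /(le_trans _); apply.
  by rewrite mulrDr mulr1 mulrC lerDl ltW.
rewrite c0 addr0 in szp pC *.
suff -> : p = 0 by rewrite mul0r.
apply: IH.
  have [->|p0] := eqVneq p 0; first by rewrite size_poly0.
  by rewrite size_mulX in szp.
move=> t /[dup] /andP[t0 _] /pC; rewrite !hornerE normrM (gtr0_norm t0).
by rewrite exprSr mulrA ler_pM2r.
Qed.

(* Both sides are Taylor coefficients at [t = 0] of [f (x + t u + t v)]:
   this bypasses the symmetry of higher derivatives. *)
Lemma dern_nseqD n f C D x u v : open D -> 0 <= C -> bsmooth n.+1 D f C -> D x ->
  dern f (nseq n (u + v)) x / n`!%:R =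
  \sum_(b < n.+1)
     (b`!%:R)^-1 * (dern (dern f (nseq b v)) (nseq (n - b) u) x / (n - b)`!%:R).
Proof.
move=> oD C0 bf Dx.
(* The double expansion: first along [v] from [x + t u], then each coefficient along [u] from [x],
   cut so that no degree exceeds [n]. *)
pose q := \sum_(b < n.+1)
  (b`!%:R)^-1 *: ('X^b * tpoly (n.+1 - b) (dern f (nseq b v)) u x).
have [r r0 rD] : exists2 r : R, 0 < r & ball x r `<=` D.
  by have /nbhs_ballP[r r0 rD] := open_nbhs_nbhs (conj oD Dx); exists r.
(* The norm of [s u + t v] is at most [max(s, t) (|u| + |v|)], so [s, t < r / w] keeps the point in
   the ball; the summand 1 makes [w] positive. *)
pose w := `|u| + `|v| + 1.
have w0 : 0 < w by rewrite ltr_wpDl// addr_ge0.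
have Dst (s t : R) : 0 <= s < r / w -> 0 <= t < r / w -> D (x + s *: u + t *: v).
  move=> /andP[s0 sr] /andP[t0 tr]; apply: rD.
  rewrite -ball_normE/= -addrA opprD addrA subrr add0r normrN.
  rewrite (le_lt_trans (ler_normD _ _))// !normrZ !ger0_norm//.
  move: sr tr; rewrite !ltr_pdivlMr// /w => sr tr.
  have [st|/ltW ts] := leP s t.
    apply: le_lt_trans tr; rewrite mulrDr mulr1 mulrDr -addrA lerD//.
      by rewrite ler_wpM2r.
    by rewrite lerDl.
  apply: le_lt_trans sr; rewrite mulrDr mulr1 mulrDr -addrA lerD//.
  rewrite (@le_trans _ _ (s * `|v|))// ?lerDl//.
  by rewrite ler_wpM2r.
have bfv b : (b <= n.+1)%N ->
    bsmooth (n.+1 - b) D (dern f (nseq b v)) (C * (d%:R * `|v|) ^+ b).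
  move=> bn; have := @bsmooth_dern _ _ (n.+1 - b) D f C (nseq b v) oD C0.
  rewrite size_nseq subnK// => /(_ bf).
  by rewrite big_nseq iter_mulr_1.
have Dv0 : 0 <= d%:R * `|v| :> R by rewrite mulr_ge0.
pose C' := C * (d%:R * `|u + v|) ^+ n.+1 + C * (d%:R * `|v|) ^+ n.+1 +
  \sum_(b < n.+1) (b`!%:R)^-1 *
     (C * (d%:R * `|v|) ^+ b * (d%:R * `|u|) ^+ (n.+1 - b)).
have e0 : 0 < r / w by rewrite divr_gt0.
(* Both polynomials approximate the same function up to [O(t^(n+1))], so they coincide; the claim is
   the equality of their coefficients of degree [n]. *)
suff : tpoly n.+1 f (u + v) x - q = 0.
  move/eqP; rewrite subr_eq0 => /eqP /(congr1 (fun p : {poly R} => p`_n)).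
  rewrite coef_poly ltnS leqnn => ->; rewrite coef_sum; apply: eq_bigr => b _.
  rewrite coefZ coefXnM ltnNge -ltnS ltn_ord/= coef_poly.
  have bn : (b <= n)%N by rewrite -ltnS.
  by rewrite subSn// ltnSn.
apply: (@poly_eq0_littleo _ n.+1 C' _ e0).
  rewrite (leq_trans (size_polyD _ _))// geq_max size_poly size_polyN/=.
  apply: (leq_trans (size_sum _ _ _)); apply/bigmax_leqP => b _.
  apply: (leq_trans (size_scale_leq _ _)).
  apply: (leq_trans (size_mul_leq _ _)).
  rewrite size_polyXn addSn/= -leq_subRL; last by rewrite ltnW.
  exact: size_poly.
move=> t /andP[t0 te].
have t0' := ltW t0.
have tt : 0 <= t < r / w by rewrite t0'.
have st (s : R) : 0 <= s <= t -> 0 <= s < r / w.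
  by move=> /andP[-> /le_lt_trans]; apply.
rewrite hornerD hornerN.
have -> : (tpoly n.+1 f (u + v) x).[t] - q.[t] =
    - (f (x + t *: (u + v)) - (tpoly n.+1 f (u + v) x).[t])
    + (f (x + t *: u + t *: v) - (tpoly n.+1 f v (x + t *: u)).[t])
    + ((tpoly n.+1 f v (x + t *: u)).[t] - q.[t]).
  by rewrite scalerDr addrA opprB !addrA !subrK.
rewrite (le_trans (ler_normD _ _))// /C' [leRHS]mulrDl lerD//.
  rewrite (le_trans (ler_normD _ _))// mulrDl lerD//.
    rewrite normrN -mulrA -exprMn; apply: taylor_bound bf _ => // s s0t.
    by rewrite scalerDr addrA; apply: Dst; exact: st.
  rewrite -mulrA -exprMn; apply: taylor_bound bf _ => // s s0t.
  by apply: Dst => //; exact: st.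
rewrite /tpoly horner_poly /q horner_sum -sumrB mulr_suml.
rewrite (le_trans (ler_norm_sum _ _ _))//; apply: ler_sum => b _.
have bn : (b <= n.+1)%N by rewrite ltnW.
rewrite hornerZ hornerM hornerXn.
have -> : dern f (nseq b v) (x + t *: u) / b`!%:R * t ^+ b -
   (b`!%:R)^-1 * (t ^+ b * (tpoly (n.+1 - b) (dern f (nseq b v)) u x).[t])
  = (b`!%:R)^-1 * (t ^+ b * (dern f (nseq b v) (x + t *: u)
      - (tpoly (n.+1 - b) (dern f (nseq b v)) u x).[t])).
  by rewrite !mulrBr; congr (_ - _); rewrite mulrC [_ / _]mulrC mulrCA.
have fb0 : 0 <= (b`!%:R^-1 : R) by rewrite invr_ge0.
rewrite normrM (ger0_norm fb0) -[leRHS]mulrA ler_wpM2l//.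
rewrite normrM (ger0_norm (exprn_ge0 b t0')).
have -> : t ^+ n.+1 = t ^+ b * t ^+ (n.+1 - b) by rewrite -exprD subnKC.
rewrite [leRHS]mulrCA ler_wpM2l ?exprn_ge0// -[leRHS]mulrA -exprMn.
apply: taylor_bound (bfv _ bn) _ => //.
  by rewrite mulr_ge0// exprn_ge0.
move=> s s0t; rewrite -[_ + _]addr0 -[0](scale0r v).
by apply: Dst; [exact: st|rewrite lexx].
Qed.

End Taylor.

(** * Sums over finite functions, split by the last value *)

Section FinfunSums.
Variables (A : nmodType) (T : finType) (n : nat).

Definition ffun_rcons (k : {ffun 'I_n -> T}) (b : T) : {ffun 'I_n.+1 -> T} :=
  [ffun j => if unlift ord_max j is Some j' then k j' else b].

Lemma ffun_rcons_max k b : ffun_rcons k b ord_max = b.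
Proof. by rewrite ffunE unlift_none. Qed.

Lemma ffun_rcons_widen k b j : ffun_rcons k b (widen_ord (leqnSn n) j) = k j.
Proof.
have -> : widen_ord (leqnSn n) j = lift ord_max j.
  by apply/val_inj; rewrite /= /bump leqNgt ltn_ord.
by rewrite ffunE liftK.
Qed.

(** Isolating the multiplicity of the last direction matches the recursion of [mtaylor] on the
    number of directions. *)
Lemma sum_ffun_recr (P : pred {ffun 'I_n.+1 -> T}) (F : {ffun 'I_n.+1 -> T} -> A) :
  \sum_(k | P k) F k =
  \sum_(b : T) \sum_(k : {ffun 'I_n -> T} | P (ffun_rcons k b)) F (ffun_rcons k b).
Proof.
rewrite pair_big_dep /= (reindex (fun p => ffun_rcons p.2 p.1)) //=.
exists (fun k : {ffun 'I_n.+1 -> T} => (k ord_max, [ffun j => k (lift ord_max j)])).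
  move=> [b k] _ /=; rewrite ffun_rcons_max; congr pair.
  by apply/ffunP => j; rewrite !ffunE liftK.
move=> k _ /=; apply/ffunP => j; rewrite ffunE.
by case: unliftP => [j' ->|->] //; rewrite ffunE.
Qed.

End FinfunSums.

(** * The multinomial theorem for iterated derivatives *)

Section Multinomial.
Variables (R : realType) (d : nat).
Local Notation V := 'rV[R]_d.
Implicit Types (D : set V) (f g : V -> R) (x y u v : V) (C h Q : R) (qs : nat -> V).

(** Scalar form of [Ksum]. The number [J] of directions and the cap [B] on multiplicities are
    decoupled from [l] and [i], so that induction on [J] is possible; [Ksum] corresponds to
    [J = l.+1] and [B = i]. *)
Definition msum qs J B f (i l : nat) x : R :=
  \sum_(k : {ffun 'I_J -> 'I_B.+1} |
          ((\sum_(j < J) (k j : nat))%N == i) &&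
          ((\sum_(j < J) (j * k j)%N)%N == l))
     (\prod_(j < J) ((k j : nat)`!)%:R)^-1 *
        dern f (flatten [seq nseq (k j) (qs (j : nat)) | j <- enum 'I_J]) x.

(* The degree-[i] Taylor term of [f] at [x] in the direction
   [\sum_(j < J) t ^+ j.+1 *: qs j], as a polynomial in [t]. *)
Fixpoint mtaylor qs x (J : nat) f (i : nat) : {poly R} :=
  match J with
  | 0 => if i == 0 then (f x)%:P else 0
  | J'.+1 => \sum_(b < i.+1)
      (b`!%:R)^-1 *: ('X^(J'.+1 * b) * mtaylor qs x J' (dern f (nseq b (qs J'))) (i - b))
  end.

(** [dern_nseqD] splits off the last direction, and its scalar comes out [b] times, giving the power
    [h ^+ (J.+1 * b)]. *)
Lemma horner_mtaylor qs x J f C D i h : open D -> 0 <= C ->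
  bsmooth i.+1 D f C -> D x ->
  (mtaylor qs x J f i).[h]
  = dern f (nseq i (\sum_(j < J) h ^+ j.+1 *: qs j)) x / i`!%:R.
Proof.
move=> oD + + Dx; elim: J f i C => [|J IH] f i C C0 bf /=.
  rewrite big_ord0; case: i bf => [|i] bf /=; first by rewrite hornerC divr1.
  by rewrite horner0 derive0 mul0r.
rewrite [in RHS]big_ord_recr /= (dern_nseqD _ _ oD C0 bf Dx) horner_sum.
apply: eq_bigr => -[b bi] _ /=; rewrite hornerZ hornerM hornerXn.
congr (_ * _).
have bf' : bsmooth (i - b).+1 D (dern f (nseq b (qs J)))
             (C * \prod_(u <- nseq b (qs J)) (d%:R * `|u|)).
  by apply: bsmooth_dern => //; rewrite size_nseq -subSn// subnK// ltnW.
have C0' : 0 <= C * \prod_(u <- nseq b (qs J)) (d%:R * `|u|).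
  by rewrite mulr_ge0// prodr_ge0// => u _; rewrite mulr_ge0.
rewrite (IH _ _ _ C0' bf') mulrA; congr (_ / _).
rewrite [RHS](@eq_dern _ _ _ D _
  (fun y => (h ^+ (J.+1 * b)) * dern f (nseq b (qs J)) y))//; last first.
  move=> y Dy; rewrite (@dern_nseqZ _ _ _ f C D)//; first by rewrite exprM.
  by apply: bsmooth_le bf => //; rewrite ltnW.
rewrite (dernZ _ oD C0' _ Dx)// size_nseq; exact: bsmooth_le bf'.
Qed.

(** Each of the [i] slots is filled with a direction carrying at least one factor [t]. *)
Lemma coef_mtaylor_lt qs x J f i r : (r < i)%N -> (mtaylor qs x J f i)`_r = 0.
Proof.
elim: J f i r => [|J IH] f i r ri /=.
  by case: i ri => //= i _; rewrite coef0.
rewrite coef_sum big1 // => -[b bi] _ /=; rewrite coefZ coefXnM.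
case: ltnP => [_|br]; first by rewrite mulr0.
rewrite IH ?mulr0// ltn_subLR// (leq_trans ri)// mulSn.
by rewrite addnAC subnKC// leq_addr.
Qed.

Lemma size_mtaylor qs x J f i : (size (mtaylor qs x J f i) <= (J * i).+1)%N.
Proof.
elim: J f i => [|J IH] f i /=.
  by case: i => //= [|i]; rewrite ?size_polyC_leq1// size_poly0.
apply: (leq_trans (size_sum _ _ _)); apply/bigmax_leqP => -[b bi] _ /=.
apply: (leq_trans (size_scale_leq _ _)); apply: (leq_trans (size_mul_leq _ _)).
rewrite size_polyXn addSn/=.
apply: (@leq_trans (J.+1 * b + (J * (i - b)).+1)); first by rewrite leq_add2l.
rewrite addnS ltnS -[X in (_ <= _ * X)%N](@subnKC b i)// mulnDr leq_add2l.
by rewrite leq_mul2r leqnSn orbT.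
Qed.

(** Each of the [J] directions contributes a sum over at most [i.+1] multiplicities, with weights
    [1/b!] bounded by 1. *)
Lemma coef_mtaylor_le qs x J f C D i r Q : open D -> 0 <= C -> 0 <= Q ->
  bsmooth i D f C -> D x -> (forall j, (j < J)%N -> `|qs j| <= Q) ->
  `|(mtaylor qs x J f i)`_r| <= C * (d%:R * Q) ^+ i * i.+1%:R ^+ J.
Proof.
move=> oD + Q0 + Dx; elim: J f i C r => [|J IH] f i C r C0 bf qQ /=.
  rewrite mulr1; case: i bf => [|i] bf /=.
    rewrite coefC mulr1; case: eqP => _; first exact: (bsmooth_bound bf).
    by rewrite normr0.
  by rewrite coef0 normr0 mulr_ge0// exprn_ge0// mulr_ge0.
have dQ0 : 0 <= d%:R * Q by rewrite mulr_ge0.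
rewrite coef_sum (le_trans (ler_norm_sum _ _ _))//.
apply: (@le_trans _ _ (\sum_(b < i.+1) C * (d%:R * Q) ^+ i * i.+1%:R ^+ J)); last first.
  by rewrite sumr_const card_ord -[leLHS]mulr_natr exprSr mulrA.
apply: ler_sum => -[b bi] _ /=; rewrite coefZ coefXnM normrM.
have X0 : 0 <= C * (d%:R * Q) ^+ i * i.+1%:R ^+ J.
  by rewrite !mulr_ge0// exprn_ge0.
case: ltnP => [_|br]; first by rewrite normr0 mulr0.
have fb : `|b`!%:R^-1 : R| <= 1.
  by rewrite ger0_norm ?invr_ge0// invf_le1 ?ler1n ?ltr0n fact_gt0.
apply: (@le_trans _ _
  (1 * `|(mtaylor qs x J (dern f (nseq b (qs J))) (i - b))`_(r - J.+1 * b)|)).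
  by rewrite ler_wpM2r.
rewrite mul1r.
have bf' : bsmooth (i - b) D (dern f (nseq b (qs J))) (C * (d%:R * Q) ^+ b).
  have := @bsmooth_dern _ _ (i - b) D f C (nseq b (qs J)) oD C0.
  rewrite size_nseq subnK// => /(_ bf); apply: bsmooth_le => //.
  rewrite ler_wpM2l// big_nseq iter_mulr_1 lerXn2r// ?nnegrE ?mulr_ge0//.
  by rewrite ler_wpM2l// qQ.
apply: (le_trans (IH _ _ _ _ _ bf' _)).
- by rewrite mulr_ge0// exprn_ge0.
- by move=> j jJ; apply: qQ; rewrite ltnW.
rewrite -[C * _ * _]mulrA -exprD subnKC// ler_wpM2l//.
  by rewrite mulr_ge0// exprn_ge0.
by rewrite lerXn2r// ?nnegrE// ler_nat ltnS leq_subr.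
Qed.

(** A tuple [k] contributes the power [\sum_j (j + 1) k_j] of [t], which is [i + l] exactly when
    [\sum_j k_j = i] and [\sum_j j k_j = l]. *)
Lemma msum_mtaylor qs x J B f i l : (i <= B)%N ->
  msum qs J B f i l x = (mtaylor qs x J f i)`_(i + l).
Proof.
elim: J f i l => [|J IH] f i l iB.
  rewrite /msum /=.
  under eq_bigl do rewrite !big_ord0.
  under eq_bigr do rewrite big_ord0 invr1 mul1r enum_ord0 /=.
  case: i {iB} => [|i] /=; last by rewrite coef0 big_pred0.
  rewrite add0n coefC; case: l => [|l] /=; last by rewrite big_pred0.
  by rewrite sumr_const card_ffun !card_ord expn0.
rewrite /msum sum_ffun_recr /= coef_sum.
rewrite (big_ord_widen_cond B.+1 xpredT (fun b => (b`!%:R^-1 *: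
  ('X^(J.+1 * b) * mtaylor qs x J (dern f (nseq b (qs J))) (i - b)))`_(i + l)))//.
rewrite [RHS]big_mkcond /=; apply: eq_bigr => b _.
have cond (k : {ffun 'I_J -> 'I_B.+1}) :
  ((\sum_(j < J.+1) (ffun_rcons k b j : nat))%N == i) &&
          ((\sum_(j < J.+1) (j * ffun_rcons k b j)%N)%N == l)
  = ((\sum_(j < J) (k j : nat) + b)%N == i) && ((\sum_(j < J) (j * k j) + J * b)%N == l).
  rewrite !big_ord_recr /= !ffun_rcons_max.
  by congr ((_ + _ == _)%N && (_ + _ == _)%N); apply: eq_bigr => j _;
    rewrite ffun_rcons_widen.
under eq_bigl do rewrite cond.
have term (k : {ffun 'I_J -> 'I_B.+1}) :
  (\prod_(j < J.+1) ((ffun_rcons k b j : nat)`!)%:R)^-1 *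
  dern f (flatten [seq nseq (ffun_rcons k b j) (qs (j : nat)) | j <- enum 'I_J.+1]) x
  = b`!%:R^-1 * ((\prod_(j < J) ((k j : nat)`!)%:R)^-1 *
    dern (dern f (nseq b (qs J))) (flatten [seq nseq (k j) (qs (j : nat)) | j <- enum 'I_J]) x).
  rewrite big_ord_recr /= ffun_rcons_max invfM mulrAC [RHS]mulrC; congr (_ / _).
  congr (_^-1 * _).
    by apply: eq_bigr => j _; rewrite ffun_rcons_widen.
  rewrite enum_ordSr map_rcons flatten_rcons ffun_rcons_max /= dern_cat -map_comp.
  congr (dern _ (flatten _) _); apply: eq_map => j /=.
  by rewrite ffun_rcons_widen.
under eq_bigr do rewrite term.
rewrite -mulr_sumr coefZ coefXnM ltnS.
(* Multiplicities [b] of the last direction with [b > i] or [J * b > l] contribute nothing to either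
   side. *)
case: (leqP b i) => [bi|ib]; last first.
  rewrite big_pred0 ?mulr0// => k.
  by rewrite gtn_eqF// ltn_addl.
case: (leqP (J * b) l) => [Jb|lJ]; last first.
  rewrite big_pred0; last first.
    by move=> k; rewrite [X in _ && X]gtn_eqF ?andbF// ltn_addl.
  case: ltnP => // Jbi; rewrite coef_mtaylor_lt// ltn_subLR//.
  by rewrite mulSn addnAC subnKC// ltn_add2l.
have -> : (i + l < J.+1 * b)%N = false.
  by apply/negbTE; rewrite -leqNgt mulSn leq_add.
rewrite mulSn subnDA addnC -addnBA// [(l + _)%N]addnC -addnBA//.
rewrite -IH; last by rewrite (leq_trans _ iB)// leq_subr.
congr (_ * _); apply: eq_bigl => k.
congr (_ && _); first by rewrite -[RHS](eqn_add2r b) subnK.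
by rewrite -[RHS](eqn_add2r (J * b)) subnK.
Qed.

(** A single use of the direction of index [J] among [i] slots already forces degree at least
    [i + J], beyond [i + l]. *)
Lemma coef_mtaylorS qs x J f i l : (l < J)%N ->
  (mtaylor qs x J.+1 f i)`_(i + l) = (mtaylor qs x J f i)`_(i + l).
Proof.
move=> lJ /=; rewrite coef_sum (bigD1 ord0)//= big1 => [|b b0].
  by rewrite addr0 coefZ fact0 invr1 mul1r muln0 mul1r subn0.
rewrite coefZ coefXnM; case: ltnP => Jb; first by rewrite mulr0.
have bi : (b <= i)%N by rewrite -ltnS.
rewrite coef_mtaylor_lt ?mulr0// ltn_subLR// mulSn addnAC subnKC// ltn_add2l.
by rewrite (leq_trans lJ)// leq_pmulr// lt0n.
Qed.

Lemma coef_mtaylor_msum qs x J f i l : (l < J)%N ->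
  (mtaylor qs x J f i)`_(i + l) = msum qs l.+1 i f i l x.
Proof.
move=> lJ; rewrite msum_mtaylor// -(subnKC lJ).
elim: (J - l.+1)%N => [|m IH]; first by rewrite addn0.
by rewrite addnS coef_mtaylorS ?IH// addSn ltnS leq_addr.
Qed.

(** A positive multiplicity forces [1 <= i], hence [j <= l < i + l]. This is why the recursion is
    well defined: higher terms only occur with multiplicity zero. *)
Lemma eq_flatten_nseq qs qs' i l (k : {ffun 'I_l.+1 -> 'I_i.+1}) :
  (forall j, (j < i + l)%N -> qs j = qs' j) ->
  flatten [seq nseq (k j) (qs (j : nat)) | j <- enum 'I_l.+1] =
  flatten [seq nseq (k j) (qs' (j : nat)) | j <- enum 'I_l.+1].
Proof.
move=> eqs; congr flatten.
apply: eq_map => j; have [k0|kj] := posnP (k j); first by rewrite k0.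
rewrite eqs//; have := ltn_ord (k j); rewrite ltnS => /(leq_trans kj) i0.
by rewrite (leq_trans (ltn_ord j))// addnC -addn1 leq_add2l.
Qed.

Lemma eq_msum qs qs' f i l x : (forall j, (j < i + l)%N -> qs j = qs' j) ->
  msum qs l.+1 i f i l x = msum qs' l.+1 i f i l x.
Proof. by move=> eqs; apply: eq_bigr => k _; rewrite (eq_flatten_nseq _ eqs). Qed.

Lemma eq_Ksum (G : V -> V) qs qs' i l x :
  (forall j, (j < i + l)%N -> qs j = qs' j) ->
  Ksum G qs i l x = Ksum G qs' i l x.
Proof. by move=> eqs; apply: eq_bigr => k _; rewrite (eq_flatten_nseq _ eqs). Qed.

Lemma Ksum_coord (G : V -> V) C D qs i l x j : open D -> 0 <= C ->
  (forall j, bsmooth i D (fun y => G y 0 j) C) -> D x ->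
  Ksum G qs i l x 0 j = msum qs l.+1 i (fun y => G y 0 j) i l x.
Proof.
move=> oD C0 bG Dx; rewrite /Ksum summxE; apply: eq_bigr => k /andP[/eqP ki _].
rewrite mxE (@dern_coord _ _ G C D)//.
rewrite size_flatten /shape -map_comp sumnE big_map.
by rewrite big_enum /=; under eq_bigr do rewrite size_nseq; rewrite ki.
Qed.

End Multinomial.

(** * Expansion of a function along an approximate curve *)

Section Expansion.
Variables (R : realType) (d : nat).
Local Notation V := 'rV[R]_d.

(* The remainder of [y] is fed to the multinomial expansion as one more
   coefficient [h ^- N.+1 *: (y - x - ...)] of order [N.+1]. *)
Lemma msum_expansion (N : nat) : exists2 kappa : R, 0 <= kappa &
  forall (f : V -> R) (C : R) (D : set V) (x y : V) (qs : nat -> V) (h Q : R),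
    open D -> (forall s : R, 0 <= s <= 1 -> D (x + s *: (y - x))) ->
    0 <= C -> 1 <= Q -> 0 < h <= 1 -> bsmooth N.+1 D f C ->
    (forall j, (j < N)%N -> `|qs j| <= Q) ->
    `|y - x - \sum_(j < N) h ^+ j.+1 *: qs j| <= Q * h ^+ N.+1 ->
    `|f y - \sum_(r < N.+1) h ^+ r *
        (\sum_(i < r.+1) msum qs (r - i).+1 i f i (r - i) x)|
      <= kappa * C * Q ^+ N.+1 * h ^+ N.+1.
Proof.
(* A bound on the size of [P] below: [N.+1] directions, Taylor degree at most [N]. *)
pose S := (N.+1 * N).+1.
(* The sum of the bounds of [coef_mtaylor_le], after [Q ^+ i] is replaced by [Q ^+ N.+1] thanks to
   [1 <= Q]. *)
pose kB : R := \sum_(i < N.+1) d%:R ^+ i * i.+1%:R ^+ N.+1.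
have kB0 : 0 <= kB by apply: sumr_ge0 => i _; rewrite mulr_ge0// exprn_ge0.
exists ((d%:R * N.+1%:R) ^+ N.+1 + S%:R * kB).
  by rewrite addr_ge0 ?mulr_ge0// exprn_ge0// mulr_ge0.
move=> f C D x y qs h Q oD Dseg C0 Q1 /andP[h0 h1] bf qQ Eh.
have Q0 : 0 <= Q by rewrite (le_trans _ Q1).
have h0' := ltW h0.
have Dx : D x by have := Dseg 0; rewrite scale0r addr0 lexx ler01; exact.
set E := y - x - _ in Eh.
pose qs' j := if (j < N)%N then qs j else (h ^+ N.+1)^-1 *: E.
have hN0 : h ^+ N.+1 != 0 by rewrite expf_neq0 ?gt_eqF.
have qs'Q j : `|qs' j| <= Q.
  rewrite /qs'; case: ifP => [/qQ//|_].
  rewrite normrZ normfV (ger0_norm (exprn_ge0 _ h0')) mulrC.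
  by rewrite ler_pdivrMr ?exprn_gt0.
have yxE : y - x = \sum_(j < N.+1) h ^+ j.+1 *: qs' j.
  rewrite big_ord_recr/= /qs' ltnn scalerA divff// scale1r /E.
  rewrite (eq_bigr (fun j : 'I_N => h ^+ j.+1 *: qs j)); last first.
    by move=> j _; rewrite ltn_ord.
  by rewrite addrC subrK.
have yx : `|y - x| <= N.+1%:R * Q * h.
  rewrite yxE (le_trans (ler_norm_sum _ _ _))//.
  apply: (@le_trans _ _ (\sum_(j < N.+1) Q * h)); last first.
    by rewrite sumr_const card_ord -[leLHS]mulr_natl mulrA.
  apply: ler_sum => j _; rewrite normrZ (ger0_norm (exprn_ge0 _ h0')) mulrC.
  by rewrite ler_pM ?exprn_ge0// exprS ler_piMr// exprn_ile1.
pose P := \sum_(i < N.+1) mtaylor qs' x N.+1 f i.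
have PE : (tpoly N.+1 f (y - x) x).[1] = P.[h].
  rewrite horner_poly horner_sum; apply: eq_bigr => i _; rewrite expr1n mulr1.
  rewrite (@horner_mtaylor _ _ qs' x N.+1 f C D)//; first by rewrite -yxE.
  exact: bsmooth_le bf.
have tay : `|f y - P.[h]| <= C * (d%:R * N.+1%:R) ^+ N.+1 * Q ^+ N.+1 * h ^+ N.+1.
  have := taylor_bound oD C0 ler01 bf Dseg.
  rewrite PE scale1r [x + _]addrC subrK => /le_trans; apply.
  rewrite -!mulrA ler_wpM2l// -!exprMn lerXn2r ?nnegrE ?mulr_ge0//.
  by rewrite mulr1 -!mulrA ler_wpM2l// mulrA.
have sizeP : (size P <= S)%N.
  apply: (leq_trans (size_sum _ _ _)); apply/bigmax_leqP => i _.
  by apply: (leq_trans (size_mtaylor _ _ _ _ _)); rewrite ltnS leq_mul2l -ltnS ltn_ord.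
have coefP r : `|P`_r| <= kB * C * Q ^+ N.+1.
  rewrite coef_sum (le_trans (ler_norm_sum _ _ _))// -mulrA mulr_suml.
  apply: ler_sum => i _.
  have bi : bsmooth i D f C by apply: bsmooth_le bf => //; rewrite ltnW.
  rewrite (le_trans (@coef_mtaylor_le _ _ qs' x N.+1 f C D i r Q _ _ _ _ _ _))//.
  have -> : C * (d%:R * Q) ^+ i * i.+1%:R ^+ N.+1
          = d%:R ^+ i * i.+1%:R ^+ N.+1 * (C * Q ^+ i) by rewrite exprMn; ring.
  rewrite ler_wpM2l ?mulr_ge0 ?exprn_ge0// ler_wpM2l// ler_weXn2l//.
  exact: ltnW.
(* Coefficients of order [r <= N] only involve directions of index below [r], so the artificial last
   direction does not enter them. *)
have lowP r : (r < N.+1)%N ->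
    P`_r = \sum_(i < r.+1) msum qs (r - i).+1 i f i (r - i) x.
  move=> rN; rewrite coef_sum.
  rewrite (big_ord_widen N.+1 (fun i => msum qs (r - i).+1 i f i (r - i) x))//.
  rewrite [RHS]big_mkcond; apply: eq_bigr => i _; rewrite ltnS.
  case: leqP => ir; last by rewrite coef_mtaylor_lt.
  rewrite -{1}(subnKC ir) coef_mtaylor_msum; last first.
    by rewrite (leq_ltn_trans _ rN)// leq_subr.
  apply: eq_msum => j; rewrite subnKC// /qs' => jr.
  by rewrite (leq_trans jr).
have -> : \sum_(r < N.+1) h ^+ r * (\sum_(i < r.+1) msum qs (r - i).+1 i f i (r - i) x)
        = \sum_(r < S | (r < N.+1)%N) P`_r * h ^+ r.
  rewrite -(big_ord_widen S (fun r => P`_r * h ^+ r)); last first.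
    by rewrite ltnS mulSn leq_addr.
  by apply: eq_bigr => r _; rewrite mulrC lowP.
have PS : P.[h] = \sum_(r < S | (r < N.+1)%N) P`_r * h ^+ r
                + \sum_(r < S | ~~ (r < N.+1)%N) P`_r * h ^+ r.
  by rewrite (horner_coef_wide _ sizeP) (bigID (fun r : 'I_S => (r < N.+1)%N)).
have high : `|\sum_(r < S | ~~ (r < N.+1)%N) P`_r * h ^+ r|
    <= S%:R * kB * C * Q ^+ N.+1 * h ^+ N.+1.
  rewrite (le_trans (ler_norm_sum _ _ _))//.
  apply: (@le_trans _ _ (\sum_(r < S) kB * C * Q ^+ N.+1 * h ^+ N.+1)); last first.
    by rewrite sumr_const card_ord -[leLHS]mulr_natl !mulrA.
  rewrite big_mkcond/=; apply: ler_sum => r _; case: ifP => [|_]; last first.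
    by rewrite !mulr_ge0// exprn_ge0.
  rewrite -leqNgt => Nr; rewrite normrM ler_pM//.
  by rewrite (ger0_norm (exprn_ge0 _ h0')) ler_wiXn2l.
rewrite (_ : f y - _ = (f y - P.[h]) +
   \sum_(r < S | ~~ (r < N.+1)%N) P`_r * h ^+ r); last first.
  by rewrite PS opprD addrA addrNK.
rewrite (le_trans (ler_normD _ _))// !mulrDl lerD//.
by rewrite [leRHS](_ : _ = C * (d%:R * N.+1%:R) ^+ N.+1 * Q ^+ N.+1 * h ^+ N.+1)// [C * _]mulrC.
Qed.

End Expansion.

(** * Closed recursions for the coefficients and the history terms *)

Section Recursion.
Variables (R : realType) (d : nat) (beta : R) (L : nat -> 'rV[R]_d -> R).
Local Notation V := 'rV[R]_d.
Local Notation coef := (coef beta L).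
Local Notation hist := (hist beta L).
Local Notation levels := (levels beta L).
Let def : cfun R d * pfun R d := ((fun _ _ => 0), (fun _ _ _ => 0)).

Lemma size_levels m : size (levels m) = m.
Proof. by elim: m => //= m IH; rewrite size_rcons IH. Qed.

Lemma nth_levels m j : (j < m)%N -> nth def (levels m) j = (coef j.+1, hist j.+1).
Proof.
elim: m => // m IH; rewrite ltnS leq_eqVlt => /orP[/eqP ->|jm].
  by rewrite /Defs.coef /Defs.hist; case: (nth _ _ _).
by rewrite [levels m.+1]/= nth_rcons size_levels jm IH.
Qed.

Lemma nth_levels_hist m j : (j < m)%N ->
  nth (fun _ _ _ => 0) (map snd (levels m)) j = hist j.+1.
Proof. by move=> jm; rewrite (nth_map def) ?size_levels// nth_levels. Qed.

Lemma nth_levels_coef m j : (j < m)%N ->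
  nth (fun _ _ => 0) (map fst (levels m)) j = coef j.+1.
Proof. by move=> jm; rewrite (nth_map def) ?size_levels// nth_levels. Qed.

Lemma coef1E n x :
  coef 1 n x = - \sum_(0 <= k < n.+1) beta ^+ k *: grad (L (n - k)%N) x.
Proof. by rewrite big_mkord. Qed.

Lemma coefSSE m n x : coef m.+2 n x =
  - \sum_(1 <= k < n.+1) beta ^+ k *: \sum_(i < m.+2)
     Ksum (grad (L (n - k)%N)) (fun j => hist j.+1 n k x) i (m.+1 - i)%N x.
Proof.
have -> : coef m.+2 n x = c_step beta L m.+2 (map snd (levels m.+1)) n x.
  by rewrite {1}/Defs.coef [Defs.levels _ _ _]/= -/(levels m.+1) nth_rcons size_levels ltnn eqxx.
congr (- _); apply: eq_bigr => k _; congr (_ *: _); apply: eq_bigr => i _.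
(* Only entries inside the list of known levels have to agree; the default of [nth] is met with
   multiplicity zero only. *)
apply: eq_Ksum => j; rewrite subnKC -1?ltnS// => jm.
by rewrite nth_levels_hist.
Qed.

Lemma histSE m n a x : hist m.+1 n a x =
  - \sum_(1 <= s < a.+1) \sum_(1 <= j < m.+2) \sum_(i < (m.+1 - j).+1)
     Ksum (coef j (n - s)%N) (fun j' => hist j'.+1 n s x) i (m.+1 - j - i)%N x.
Proof.
have -> : hist m.+1 n a x =
    p_step m.+1 (map fst (levels m.+1)) (map snd (levels m)) n a x.
  rewrite {1}/Defs.hist [Defs.levels _ _ _]/= nth_rcons size_levels ltnn eqxx /=.
  by rewrite map_rcons.
congr (- _); apply: eq_bigr => s _.
rewrite big_nat_cond [RHS]big_nat_cond; apply: eq_bigr => j /andP[/andP[j0 jm] _].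
apply: eq_bigr => i _; have im : (i <= m.+1 - j)%N by rewrite -ltnS.
rewrite nth_levels_coef ?prednK//.
apply: eq_Ksum => j'; rewrite subnKC// => j'm.
by rewrite nth_levels_hist// (leq_trans j'm)// leq_subLR -{1}(prednK j0) addSn ltnS leq_addl.
Qed.

End Recursion.

(** * Geometric sums with polynomial weights *)

Section DiscountedSums.
Variable R : realType.

Lemma ler_sub_exprS (x : R) (q : nat) : 0 <= x ->
  (x + 1) ^+ q.+1 - x ^+ q.+1 <= q.+1%:R * (x + 1) ^+ q.
Proof.
move=> x0; rewrite subrXX [x + 1 - x]addrAC subrr add0r mul1r.
apply: (@le_trans _ _ (\sum_(i < q.+1) (x + 1) ^+ q)); last first.
  by rewrite sumr_const card_ord mulr_natl.
apply: ler_sum => i _; have iq : (i <= q)%N by rewrite -ltnS.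
rewrite /= -[X in _ <= _ ^+ X](subnK iq) exprD ler_wpM2l//.
  by rewrite exprn_ge0// addr_ge0.
by rewrite lerXn2r ?nnegrE ?addr_ge0// lerDl.
Qed.

(* Summation by parts lowers the exponent [q] by one. *)
Lemma discounted_sum_bounded (beta : R) (q : nat) : 0 < beta < 1 ->
  exists2 B : R, 0 <= B & forall n, \sum_(k < n) beta ^+ k * k.+1%:R ^+ q <= B.
Proof.
move=> /andP[b0 b1]; have b1' : 0 < 1 - beta by rewrite subr_gt0.
elim: q => [|q [B B0 HB]].
  exists (1 - beta)^-1; first by rewrite invr_ge0 ltW.
  move=> n; rewrite -[leRHS]mul1r ler_pdivlMr//.
  have : (\sum_(k < n) beta ^+ k * k.+1%:R ^+ 0) * (1 - beta) = 1 - beta ^+ n.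
    elim: n => [|n IH]; first by rewrite big_ord0 mul0r subrr.
    by rewrite big_ord_recr/= mulrDl IH exprS; ring.
  by move=> ->; rewrite gerBl exprn_ge0// ltW.
exists (q.+1%:R * B / (1 - beta)).
  by rewrite mulr_ge0 ?invr_ge0 ?mulr_ge0// ltW.
move=> n; rewrite ler_pdivlMr//.
(* The boundary term of the summation by parts is kept on the left so that the induction on [n]
   closes. *)
have : (\sum_(k < n) beta ^+ k * k.+1%:R ^+ q.+1) * (1 - beta)
     + beta ^+ n * n%:R ^+ q.+1
     <= q.+1%:R * (\sum_(k < n) beta ^+ k * k.+1%:R ^+ q).
  elim: n => [|n IH]; first by rewrite !big_ord0 !mul0r mulr0 expr0n/= mulr0 addr0.
  rewrite !big_ord_recr/= [leRHS]mulrDr.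
  have -> (S a : R) : (S + beta ^+ n * a) * (1 - beta) + beta ^+ n.+1 * a
    = (S * (1 - beta) + beta ^+ n * n%:R ^+ q.+1) + beta ^+ n * (a - n%:R ^+ q.+1).
    by rewrite exprS; ring.
  rewrite lerD// mulrCA ler_wpM2l ?exprn_ge0 ?(ltW b0)//.
  by rewrite -[n.+1%:R]natr1 ler_sub_exprS.
move=> H; apply: (@le_trans _ _ (q.+1%:R * (\sum_(k < n) beta ^+ k * k.+1%:R ^+ q))).
  by apply: le_trans H; rewrite lerDl mulr_ge0// exprn_ge0// ltW.
by rewrite ler_wpM2l.
Qed.

End DiscountedSums.

(** * Smoothness of the coefficients, uniform in the losses *)

Section UniformFamilies.
Variables (R : realType) (d : nat) (beta : R) (k0 : nat) (M : R).
Hypothesis beta01 : 0 < beta < 1.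
Hypothesis M0 : 0 <= M.
Local Notation V := 'rV[R]_d.

(** Packing the domain with the losses lets constants be chosen before them, which is how uniformity
    is expressed below. *)
Record losses := Losses {
  dom : set V;
  loss : nat -> V -> R;
  dom_open : open dom;
  loss_smooth : forall n, bsmooth k0 dom (loss n) M }.

Arguments dom_open : clear implicits.

Implicit Types (P : losses) (F G : losses -> nat -> nat -> V -> R)
  (c : losses -> nat -> V -> R).

Definition ubsmooth m F := exists (A : R) q, 0 <= A /\
  forall P n a, bsmooth m (dom P) (F P n a) (A * a.+1%:R ^+ q).

Definition ubsmooth0 m c := exists A : R, 0 <= A /\
  forall P n, bsmooth m (dom P) (c P n) A.

Lemma ubsmooth_le m m' F : (m' <= m)%N -> ubsmooth m F -> ubsmooth m' F.
Proof.
move=> mm [A [q [A0 H]]]; exists A, q; split => // P n a.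
exact: bsmooth_le (H P n a).
Qed.

Lemma eq_ubsmooth m F G :
  (forall P n a x, dom P x -> F P n a x = G P n a x) ->
  ubsmooth m F -> ubsmooth m G.
Proof.
move=> FG [A [q [A0 H]]]; exists A, q; split => // P n a.
by apply: eq_bsmooth (H P n a) => [|y]; [exact: dom_open|exact: FG].
Qed.

Lemma eq_ubsmooth0 m c c' :
  (forall P n x, dom P x -> c P n x = c' P n x) ->
  ubsmooth0 m c -> ubsmooth0 m c'.
Proof.
move=> FG [A [A0 H]]; exists A; split => // P n.
by apply: eq_bsmooth (H P n) => [|y]; [exact: dom_open|exact: FG].
Qed.

Lemma ubsmooth_pd m F j : ubsmooth m.+1 F ->
  ubsmooth m (fun P n a => pd j (F P n a)).
Proof.
by move=> [A [q [A0 H]]]; exists A, q; split => // P n a; exact: bsmooth_pd.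
Qed.

Lemma ubsmooth_cst0 m : ubsmooth m (fun _ _ _ _ => 0).
Proof.
exists 0, 0%N; split => // P n a; rewrite mul0r.
by have := bsmooth_cst m (dom P) 0; rewrite normr0.
Qed.

Lemma ler_natX (a q q' : nat) : (q <= q')%N -> (a.+1%:R ^+ q <= a.+1%:R ^+ q' :> R).
Proof. by move=> qq; rewrite ler_weXn2l// ler1n. Qed.

Lemma ubsmoothD m F G : ubsmooth m F -> ubsmooth m G ->
  ubsmooth m (fun P n a x => F P n a x + G P n a x).
Proof.
move=> [A [q [A0 HF]]] [B [r [B0 HG]]].
exists (A + B), (maxn q r); split=> [|P n a]; first exact: addr_ge0.
apply: bsmooth_le (leqnn m) _ (bsmoothD (dom_open P) (HF P n a) (HG P n a)).
by rewrite mulrDl lerD// ler_wpM2l// ler_natX ?leq_maxl ?leq_maxr.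
Qed.

Lemma ubsmoothM m F G : ubsmooth m F -> ubsmooth m G ->
  ubsmooth m (fun P n a x => F P n a x * G P n a x).
Proof.
move=> [A [q [A0 HF]]] [B [r [B0 HG]]].
exists (2 ^+ m * (A * B)), (q + r)%N; split=> [|P n a].
  by rewrite !mulr_ge0// exprn_ge0.
have wA : 0 <= A * a.+1%:R ^+ q by rewrite mulr_ge0// exprn_ge0.
have wB : 0 <= B * a.+1%:R ^+ r by rewrite mulr_ge0// exprn_ge0.
have := bsmoothM (dom_open P) wA wB (HF P n a) (HG P n a).
suff -> : 2 ^+ m * (A * a.+1%:R ^+ q * (B * a.+1%:R ^+ r))
  = 2 ^+ m * (A * B) * a.+1%:R ^+ (q + r) by [].
by rewrite exprD; ring.
Qed.

Lemma ubsmoothZ m F (e : R) : ubsmooth m F ->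
  ubsmooth m (fun P n a x => e * F P n a x).
Proof.
move=> [A [q [A0 HF]]]; exists (`|e| * A), q; split=> [|P n a].
  by rewrite mulr_ge0.
by rewrite -mulrA; apply: bsmoothZ => //; exact: dom_open.
Qed.

Lemma ubsmooth_sum m (I : Type) (r : seq I) (p : pred I)
    (F : I -> losses -> nat -> nat -> V -> R) :
  (forall i, p i -> ubsmooth m (F i)) ->
  ubsmooth m (fun P n a x => \sum_(i <- r | p i) F i P n a x).
Proof.
move=> HF; elim: r => [|i r IH].
  apply: eq_ubsmooth (ubsmooth_cst0 m) => P n a x _; by rewrite big_nil.
case: (boolP (p i)) => pi.
  apply: eq_ubsmooth (ubsmoothD (HF _ pi) IH) => P n a x _.
  by rewrite big_cons pi.
by apply: eq_ubsmooth IH => P n a x _; rewrite big_cons (negbTE pi).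
Qed.

(** Summing over [a] ages raises the exponent of the weight by one. *)
Lemma ubsmooth_hist_sum m F : ubsmooth m F ->
  ubsmooth m (fun P n a x => \sum_(1 <= s < a.+1) F P n s x).
Proof.
move=> [A [q [A0 HF]]]; exists A, q.+1; split => // P n a.
have := @bsmooth_sum _ _ _ (index_iota 1 a.+1) xpredT m _ _ _ (dom_open P)
  (fun s _ => HF P n s).
apply: bsmooth_le => //.
apply: (@le_trans _ _ (\sum_(1 <= s < a.+1) A * a.+1%:R ^+ q)).
  rewrite big_nat_cond [leRHS]big_nat_cond; apply: ler_sum => s /andP[/andP[_ sa] _].
  by rewrite ler_wpM2l// lerXn2r ?nnegrE// ler_nat.
rewrite sumr_const_nat subn1/= exprS mulrCA -[leLHS]mulr_natl ler_wpM2r//.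
  by rewrite mulr_ge0// exprn_ge0.
by rewrite ler_nat.
Qed.

(** The discount [beta ^+ k] absorbs the polynomial weight in the age [k], so the bound is uniform
    in [n]. *)
Lemma ubsmooth_discounted_sum m F k1 : ubsmooth m F ->
  ubsmooth0 m (fun P n x => \sum_(k1 <= k < n.+1) beta ^+ k * F P n k x).
Proof.
move=> [A [q [A0 HF]]]; have [B B0 HB] := discounted_sum_bounded q beta01.
have bk k : 0 <= beta ^+ k by rewrite exprn_ge0// ltW//; case/andP: beta01.
exists (A * B); split=> [|P n]; first exact: mulr_ge0.
have := @bsmooth_sum _ _ _ (index_iota k1 n.+1) xpredT m _ _ _ (dom_open P)
  (fun k _ => bsmoothZ (beta ^+ k) (dom_open P) (HF P n k)).
apply: bsmooth_le => //.
apply: (@le_trans _ _ (\sum_(0 <= k < n.+1) A * (beta ^+ k * k.+1%:R ^+ q))).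
  rewrite [leRHS](bigID (fun k => (k1 <= k)%N))/=.
  have [k1n|nk1] := leqP k1 n.+1; last first.
    rewrite big_geq ?(ltnW nk1)// addr_ge0// sumr_ge0// => k _;
      by rewrite !mulr_ge0// exprn_ge0.
  have -> : \sum_(0 <= k < n.+1 | (k1 <= k)%N) A * (beta ^+ k * k.+1%:R ^+ q)
     = \sum_(k1 <= k < n.+1) A * (beta ^+ k * k.+1%:R ^+ q).
    rewrite (@big_cat_nat _ _ _ k1)//= big_nat_cond big_pred0 ?add0r.
      rewrite big_nat_cond [RHS]big_nat_cond; apply: eq_bigl => k.
      by rewrite andbT; case: (k1 <= k)%N; rewrite ?andbF// andbT.
    by move=> k; case: ltnP => // kk; rewrite andbF.
  rewrite -[leLHS]addr0 lerD//.
    by apply: ler_sum => k _; rewrite ger0_norm// mulrCA.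
  by rewrite sumr_ge0// => k _; rewrite !mulr_ge0// exprn_ge0.
by rewrite -mulr_sumr ler_wpM2l// big_mkord.
Qed.

Lemma ubsmooth0N m c : ubsmooth0 m c -> ubsmooth0 m (fun P n x => - c P n x).
Proof.
move=> [A [A0 H]]; exists A; split => // P n.
have := bsmoothZ (-1) (dom_open P) (H P n); rewrite normrN1 mul1r.
by apply: (eq_bsmooth (dom_open P)) => y _; rewrite mulN1r.
Qed.

Lemma ubsmoothN m F : ubsmooth m F -> ubsmooth m (fun P n a x => - F P n a x).
Proof.
by move/(ubsmoothZ (-1)); apply: eq_ubsmooth => P n a x _; rewrite mulN1r.
Qed.

Lemma ubsmooth0_shift m c : ubsmooth0 m c ->
  ubsmooth m (fun P n a => c P (n - a)%N).
Proof.
by move=> [A [A0 H]]; exists A, 0%N; split => // P n a; rewrite mulr1.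
Qed.

Definition ubsmoothV m (G : losses -> nat -> nat -> V -> V) :=
  forall j, ubsmooth m (fun P n a x => G P n a x 0 j).

Lemma ubsmoothV_le m m' (G : losses -> nat -> nat -> V -> V) :
  (m' <= m)%N -> ubsmoothV m G -> ubsmoothV m' G.
Proof. by move=> mm H j; exact: ubsmooth_le (H j). Qed.

Lemma ubsmoothV_bound m (G : losses -> nat -> nat -> V -> V) :
  ubsmoothV m G -> exists (A : R) q, 0 <= A /\
  forall P n a j, bsmooth m (dom P) (fun x => G P n a x 0 j) (A * a.+1%:R ^+ q).
Proof.
move=> H; have /choice[A HA] := H; have /choice[q Hq] := HA.
exists (\sum_j A j), (\max_j q j); split=> [|P n a j].
  by apply: sumr_ge0 => j _; case: (Hq j).
have [Aj Hj] := Hq j; apply: bsmooth_le (leqnn m) _ (Hj P n a).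
rewrite ler_pM ?exprn_ge0//; last exact/ler_natX/leq_bigmax.
by rewrite (bigD1 j)//= lerDl sumr_ge0// => i _; case: (Hq i).
Qed.

(** The directions vary with [x]. Expanding the innermost one in coordinates gives a sum of products
    of its coordinates with derivatives of partial derivatives, to which the closure properties
    apply. *)
Lemma ubsmooth_dern m F (us : seq (losses -> nat -> nat -> V -> V)) :
  ubsmooth (m + size us) F ->
  (forall i, (i < size us)%N -> ubsmoothV m (nth (fun _ _ _ _ => 0) us i)) ->
  ubsmooth m (fun P n a x => dern (F P n a) [seq u P n a x | u <- us] x).
Proof.
elim/last_ind: us F => [|us u IH] F; first by rewrite addn0.
rewrite size_rcons addnS => HF Hus.
have Hu : ubsmoothV m u.
  by have := Hus (size us); rewrite nth_rcons ltnn eqxx; apply.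
have Hus' i : (i < size us)%N -> ubsmoothV m (nth (fun _ _ _ _ => 0) us i).
  by move=> ius; have := Hus i; rewrite nth_rcons ius; apply; rewrite ltnW.
apply: eq_ubsmooth (ubsmooth_sum (index_enum 'I_d) (p := xpredT) (fun j _ =>
  ubsmoothM (Hu j) (IH _ (ubsmooth_pd j HF) Hus'))) => P n a x Px.
rewrite map_rcons; have [A [q [A0 HA]]] := HF.
rewrite (@dern_rcons_sum _ _ _ (A * a.+1%:R ^+ q) (dom P))//.
- exact: dom_open.
- by rewrite mulr_ge0// exprn_ge0.
- by rewrite size_map; apply: bsmooth_le (HA P n a); rewrite // ltnS leq_addl.
Qed.

Lemma ubsmooth_Ksum m (G : losses -> nat -> nat -> V -> V)
    (q : nat -> losses -> nat -> nat -> V -> V) i l :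
  ubsmoothV (m + i) G -> (forall j, (j < i + l)%N -> ubsmoothV m (q j)) ->
  ubsmoothV m (fun P n a x => Ksum (G P n a) (fun j => q j P n a x) i l x).
Proof.
move=> HG Hq j0; have [A [r [A0 HA]]] := ubsmoothV_bound HG.
apply: (@eq_ubsmooth _ (fun P n a x => msum (fun j => q j P n a x) l.+1 i
    (fun y => G P n a y 0 j0) i l x)).
  move=> P n a x Px; rewrite (@Ksum_coord _ _ _ (A * a.+1%:R ^+ r) (dom P))//.
  - exact: dom_open.
  - by rewrite mulr_ge0// exprn_ge0.
  - by move=> j; apply: bsmooth_le (HA P n a j); rewrite // leq_addl.
apply: ubsmooth_sum => k /andP[/eqP ki _]; apply: ubsmoothZ.
pose us := flatten [seq nseq (k j) (q (j : nat)) | j <- enum 'I_l.+1].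
have sus : size us = i.
  rewrite size_flatten /shape -map_comp sumnE big_map big_enum/= -[RHS]ki.
  by apply: eq_bigr => j _; rewrite /= size_nseq.
apply: (@eq_ubsmooth _ (fun P n a x => dern (fun y => G P n a y 0 j0)
   [seq u P n a x | u <- us] x)).
  move=> P n a x _; rewrite map_flatten -map_comp; congr (dern _ (flatten _) _).
  by apply: eq_map => j; rewrite /= map_nseq.
apply: ubsmooth_dern; first by rewrite sus.
(* Membership is taken propositionally, since the entries are functions. *)
suff H u : List.In u us -> ubsmoothV m u.
  move=> t tus; apply: H; elim: us t tus {sus} => // u us IH [|t] /=; first by left.
  by rewrite ltnS => /IH; right.
rewrite /us; elim: (enum 'I_l.+1) => //= j s IH usj.
have [uj|/IH//] := List.in_app_or _ _ _ usj.
have [kj0|kj] := posnP (k j); first by rewrite kj0 in uj.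
have -> : u = q j by elim: (nat_of_ord (k j)) uj => //= t IHt [].
apply: Hq; have := ltn_ord (k j); rewrite ltnS => /(leq_trans kj) i0.
by rewrite (leq_trans (ltn_ord j))// addnC -addn1 leq_add2l.
Qed.

Definition ucoef m P n := coef beta (loss P) m n.
Definition uhist m P n a := hist beta (loss P) m n a.

Lemma bsmooth_grad P n j : (0 < k0)%N ->
  bsmooth (k0 - 1) (dom P) (fun x => grad (loss P n) x 0 j) M.
Proof.
have := @loss_smooth P n; case: (k0) => // k1.
rewrite subn1/= => /(bsmooth_pd j) H _.
by apply: (eq_bsmooth (dom_open P) _ H) => y _; rewrite mxE.
Qed.

Lemma ubsmoothV_grad : (0 < k0)%N ->
  ubsmoothV (k0 - 1) (fun P n a => grad (loss P (n - a))).
Proof.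
move=> k00 j; exists M, 0%N; split => // P n a; rewrite mulr1.
exact: bsmooth_grad.
Qed.

(** Each level costs one derivative: a term with [i] derivatives of a map of level [j] satisfies
    [i + j <= m.+1], where the gradient counts as level 1. The coefficient is treated first, since
    the history term of the same level contains it. *)
Lemma ubsmooth_coef_hist m : (m < k0)%N ->
  (forall j, ubsmooth0 (k0 - m.+1) (fun P n x => ucoef m.+1 P n x 0 j)) /\
  ubsmoothV (k0 - m.+1) (uhist m.+1).
Proof.
elim/ltn_ind: m => m IH mk.
have HL := ubsmoothV_grad (leq_ltn_trans (leq0n m) mk).
have Hh m' j : (j < m')%N -> (m' <= m)%N -> ubsmoothV (k0 - m') (uhist j.+1).
  move=> jm m'm; have jm2 := leq_trans jm m'm.
  have [_] := IH j jm2 (ltn_trans jm2 mk).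
  by apply: ubsmoothV_le; rewrite leq_sub2l.
have Hc j : ubsmooth0 (k0 - m.+1) (fun P n x => ucoef m.+1 P n x 0 j).
  case: m IH mk Hh => [|m] IH mk Hh.
    apply: eq_ubsmooth0 (ubsmooth0N (ubsmooth_discounted_sum 0 (HL j))) => P n x _.
    rewrite /ucoef coef1E mxE summxE; congr (- _).
    by apply: eq_bigr => k _; rewrite [RHS]mxE.
  pose F i : losses -> nat -> nat -> V -> V := fun P n k x => Ksum (grad (loss P (n - k)%N))
    (fun j => uhist j.+1 P n k x) i (m.+1 - i) x.
  have HF (i : 'I_m.+2) : ubsmoothV (k0 - m.+2) (F i).
    have im : (i <= m.+1)%N by rewrite -ltnS.
    apply: ubsmooth_Ksum.
      by apply: ubsmoothV_le HL; lia.
    by move=> j'; rewrite subnKC// => j'm; apply: (ubsmoothV_le _ (Hh m.+1 _ j'm _)) => //; lia.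
  apply: eq_ubsmooth0 (ubsmooth0N (ubsmooth_discounted_sum 1
    (ubsmooth_sum (index_enum 'I_m.+2) (p := xpredT) (fun i _ => HF i j)))) => P n x _.
  rewrite /ucoef coefSSE mxE summxE; congr (- _).
  by apply: eq_bigr => k _; rewrite [RHS]mxE summxE.
split=> // j0.
have Hc' j : (0 < j <= m.+1)%N ->
    forall i, ubsmooth0 (k0 - j) (fun P n x => ucoef j P n x 0 i).
  case: j => // j /andP[_]; rewrite ltnS leq_eqVlt => /orP[/eqP ->//|jm].
  by have [] := IH j jm (ltn_trans jm mk).
pose F j i : losses -> nat -> nat -> V -> V := fun P n s x => Ksum (ucoef j P (n - s)%N)
    (fun j => uhist j.+1 P n s x) i (m.+1 - j - i) x.
have HF j i : (0 < j <= m.+1)%N -> (i <= m.+1 - j)%N -> ubsmoothV (k0 - m.+1) (F j i).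
  move=> jm im; apply: ubsmooth_Ksum.
    move=> j1; apply: ubsmooth_le (ubsmooth0_shift (Hc' _ jm j1)); lia.
  move=> j'; rewrite subnKC// => j'm.
  apply: (ubsmoothV_le _ (Hh m _ _ _)) => //; lia.
have HS : ubsmooth (k0 - m.+1) (fun P n s x =>
   \sum_(j <- index_iota 1 m.+2 | (0 < j <= m.+1)%N)
   \sum_(i < (m.+1 - j).+1) F j i P n s x 0 j0).
  apply: ubsmooth_sum => j jm; apply: ubsmooth_sum => i _.
  by apply: (HF j i jm _ j0); rewrite -ltnS.
apply: eq_ubsmooth (ubsmoothN (ubsmooth_hist_sum HS)) => P n a x _.
rewrite /uhist histSE mxE summxE; congr (- _); apply: eq_bigr => s _.
rewrite summxE big_nat_cond [RHS]big_nat_cond; apply: eq_big => j.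
  by rewrite andbT ltnS andbb.
by move=> _; rewrite summxE.
Qed.

End UniformFamilies.

(** * Backward expansion of the memoryless trajectory *)

Section Trajectories.
Variables (R : realType) (d : nat) (beta : R) (K : nat) (M : R).
Hypothesis beta01 : 0 < beta < 1.
Hypothesis M0 : 0 <= M.
Local Notation V := 'rV[R]_d.
Local Notation losses := (losses d (2 * K) M).
Local Notation coef P := (coef beta (loss P)).
Local Notation hist P := (hist beta (loss P)).

Definition trajectory (P : losses) (h : R) (tt : nat -> V) :=
  [/\ (forall x y (s : R), dom P x -> dom P y -> 0 <= s <= 1 -> dom P (x + s *: (y - x))),
      0 < h <= 1, is_memoryless beta (loss P) K h tt & forall n, dom P (tt n)].

(** The constants precede the losses, the step size and the trajectory. The condition [a <= n] makes
    the truncated [n - a] a genuine difference. *)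
Definition bigO (N : nat) (F : losses -> R -> (nat -> V) -> nat -> nat -> V) :=
  exists (A : R) q, 0 <= A /\ forall P h tt n a, trajectory P h tt -> (a <= n)%N ->
    `|F P h tt n a| <= A * a.+1%:R ^+ q * h ^+ N.

Lemma eq_bigO N F G : (forall P h tt n a, trajectory P h tt -> (a <= n)%N ->
    F P h tt n a = G P h tt n a) -> bigO N F -> bigO N G.
Proof.
move=> FG [A [q [A0 H]]]; exists A, q; split => // P h tt n a tr an.
by rewrite -FG//; exact: H.
Qed.

Lemma bigO_le N N' F : (N' <= N)%N -> bigO N F -> bigO N' F.
Proof.
move=> NN [A [q [A0 H]]]; exists A, q; split => // P h tt n a tr an.
apply: (le_trans (H _ _ _ _ _ tr an)); case: tr => _ /andP[h0 h1] _ _.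
by rewrite ler_wpM2l ?mulr_ge0 ?exprn_ge0// ler_wiXn2l// ltW.
Qed.

Lemma bigO0 N : bigO N (fun _ _ _ _ _ => 0).
Proof.
by exists 0, 0%N; split => // P h tt n a _ _; rewrite normr0 !mul0r.
Qed.

Lemma bigOD N F G : bigO N F -> bigO N G ->
  bigO N (fun P h tt n a => F P h tt n a + G P h tt n a).
Proof.
move=> [A [q [A0 HF]]] [B [r [B0 HG]]].
exists (A + B), (maxn q r); split=> [|P h tt n a tr an]; first exact: addr_ge0.
rewrite (le_trans (ler_normD _ _))//.
have h0 : 0 <= h by case: tr => _ /andP[/ltW].
rewrite !mulrDl lerD//.
  rewrite (le_trans (HF _ _ _ _ _ tr an))// ler_wpM2r ?exprn_ge0//.
  by rewrite ler_wpM2l// ler_natX ?leq_maxl.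
rewrite (le_trans (HG _ _ _ _ _ tr an))// ler_wpM2r ?exprn_ge0//.
by rewrite ler_wpM2l// ler_natX ?leq_maxr.
Qed.

Lemma bigO_sum N (I : Type) (s : seq I) (p : pred I)
    (F : I -> losses -> R -> (nat -> V) -> nat -> nat -> V) :
  (forall i, p i -> bigO N (F i)) ->
  bigO N (fun P h tt n a => \sum_(i <- s | p i) F i P h tt n a).
Proof.
move=> HF; elim: s => [|i s IH].
  by apply: eq_bigO (bigO0 N) => *; rewrite big_nil.
case: (boolP (p i)) => pi.
  by apply: eq_bigO (bigOD (HF _ pi) IH) => *; rewrite big_cons pi.
by apply: eq_bigO IH => *; rewrite big_cons (negbTE pi).
Qed.

Lemma bigON N F : bigO N F -> bigO N (fun P h tt n a => - F P h tt n a).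
Proof.
move=> [A [q [A0 H]]]; exists A, q; split => // P h tt n a tr an.
by rewrite normrN; exact: H.
Qed.

Lemma bigO_scale N F j : bigO N F ->
  bigO (j + N) (fun P h tt n a => h ^+ j *: F P h tt n a).
Proof.
move=> [A [q [A0 H]]]; exists A, q; split => // P h tt n a tr an.
have h0 : 0 <= h by case: tr => _ /andP[/ltW].
rewrite normrZ (ger0_norm (exprn_ge0 _ h0)) exprD mulrCA.
by rewrite ler_wpM2l ?exprn_ge0// H.
Qed.

Lemma bigO_hist_sum N F : bigO N F ->
  bigO N (fun P h tt n a => \sum_(1 <= s < a.+1) F P h tt n s).
Proof.
move=> [A [q [A0 H]]]; exists A, q.+1; split => // P h tt n a tr an.
have h0 : 0 <= h by case: tr => _ /andP[/ltW].
rewrite (le_trans (ler_norm_sum _ _ _))//.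
apply: (@le_trans _ _ (\sum_(1 <= s < a.+1) A * a.+1%:R ^+ q * h ^+ N)).
  rewrite big_nat_cond [leRHS]big_nat_cond; apply: ler_sum => s /andP[/andP[_ sa] _].
  rewrite (le_trans (H _ _ _ _ _ tr _)) ?(leq_trans _ an)//.
  by rewrite ler_wpM2r ?exprn_ge0// ler_wpM2l// lerXn2r ?nnegrE// ler_nat.
rewrite sumr_const_nat subn1/= exprS -[leLHS]mulr_natl !mulrA ler_wpM2r ?exprn_ge0//.
rewrite ler_wpM2r ?exprn_ge0// mulrC ler_wpM2l// ler_nat.
exact: leqnSn.
Qed.

Lemma bigO_bounded (G : losses -> nat -> nat -> V -> V)
    (y : (nat -> V) -> nat -> nat -> V) m :
  ubsmoothV m G ->
  (forall P h tt n a, trajectory P h tt -> dom P (y tt n a)) ->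
  bigO 0 (fun P h tt n a => G P n a (y tt n a)).
Proof.
move=> /ubsmoothV_bound[A [q [A0 HA]]] Hy.
exists A, q; split=> // P h tt n a tr an; rewrite expr0 mulr1.
apply: mx_norm_le => [|i j]; first by rewrite mulr_ge0// exprn_ge0.
by rewrite (ord1 i); apply: (bsmooth_bound (HA P n a j)); exact: Hy tr.
Qed.

Lemma bigO_histories N : (N <= 2 * K)%N -> exists (B : R) r, 0 <= B /\
  forall P h tt n a j, trajectory P h tt -> (a <= n)%N -> (j < N)%N ->
    `|hist P j.+1 n a (tt n)| <= B * a.+1%:R ^+ r.
Proof.
elim: N => [|N IH] NK; first by exists 0, 0%N; split.
have [B [r [B0 HB]]] := IH (ltnW NK).
have [_ HN] := ubsmooth_coef_hist d beta01 M0 NK.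
have [A [q [A0 HA]]] := @bigO_bounded _ (fun tt n _ => tt n) _ HN
  (fun P h tt n a tr => let: And4 _ _ _ H := tr in H n).
exists (A + B), (maxn q r); split=> [|P h tt n a j tr an]; first exact: addr_ge0.
rewrite mulrDl ltnS leq_eqVlt => /orP[/eqP ->|jN].
  apply: (le_trans (HA _ _ _ _ _ tr an)); rewrite expr0 mulr1.
  rewrite -[leLHS]addr0 lerD ?mulr_ge0 ?exprn_ge0//.
  by rewrite ler_wpM2l// ler_natX ?leq_maxl.
apply: (le_trans (HB _ _ _ _ _ _ tr an jN)).
rewrite -[leLHS]add0r lerD ?mulr_ge0 ?exprn_ge0//.
by rewrite ler_wpM2l// ler_natX ?leq_maxr.
Qed.

Definition backward N (P : losses) (h : R) (tt : nat -> V) n a : V :=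
  tt (n - a)%N - tt n - \sum_(m < N) h ^+ m.+1 *: hist P m.+1 n a (tt n).

(** The coefficient of [h ^+ r] in the formal expansion of [G] at [x + \sum_j h ^+ j.+1 *: qs j]. *)
Definition Kpart (G : V -> V) (qs : nat -> V) r (x : V) : V :=
  \sum_(i < r.+1) Ksum G qs i (r - i) x.

(** [msum_expansion] applied to each coordinate, with [Q] polynomial in the age; the power
    [Q ^+ N.+1] is again polynomial. *)
Lemma bigO_expansion N (G : losses -> nat -> nat -> V -> V) :
  (N < 2 * K)%N -> ubsmoothV N.+1 G -> bigO N.+1 (backward N) ->
  bigO N.+1 (fun P h tt n a => G P n a (tt (n - a)%N) -
    \sum_(r < N.+1) h ^+ r *:
       Kpart (G P n a) (fun j => hist P j.+1 n a (tt n)) r (tt n)).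
Proof.
move=> NK /ubsmoothV_bound[A [q [A0 HA]]] [B [r [B0 HB]]].
have [B' [r' [B'0 HB']]] := bigO_histories (ltnW NK).
have [kappa kappa0 Hk] := @msum_expansion R d N.
(* [B] controls the remainder, [B'] the history terms, and the summand 1 ensures [1 <= Q] below. *)
pose C := (B + B' + 1).
have C0 : 0 <= C by rewrite !addr_ge0.
exists (kappa * A * C ^+ N.+1), (q + (maxn r r') * N.+1)%N.
split=> [|P h tt n a tr an]; first by rewrite !mulr_ge0// exprn_ge0.
have [Dc h01 _ Dt] := tr.
have w0 : 0 <= A * a.+1%:R ^+ q by rewrite mulr_ge0// exprn_ge0.
apply: mx_norm_le => [|i j].
  by rewrite !mulr_ge0 ?exprn_ge0 ?mulr_ge0//; case/andP: h01 => /ltW.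
rewrite (ord1 i) !mxE summxE.
have -> : \sum_(r0 < N.+1) (h ^+ r0 *: Kpart (G P n a)
      (fun j => hist P j.+1 n a (tt n)) r0 (tt n)) 0 j =
  \sum_(r0 < N.+1) h ^+ r0 * (\sum_(i < r0.+1) msum (fun j => hist P j.+1 n a (tt n))
      (r0 - i).+1 i (fun y => G P n a y 0 j) i (r0 - i) (tt n)).
  apply: eq_bigr => r0 _; rewrite mxE summxE; congr (_ * _); apply: eq_bigr => i0 _.
  rewrite (@Ksum_coord _ _ _ (A * a.+1%:R ^+ q) (dom P))//.
    exact: dom_open.
  move=> j'; apply: bsmooth_le (HA P n a j') => //.
  by rewrite (leq_trans (ltnW (ltn_ord i0))).
pose Q := C * a.+1%:R ^+ (maxn r r').
have a1 q' : 1 <= a.+1%:R ^+ q' :> R by rewrite exprn_ege1// ler1n.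
have BC : B <= C by rewrite /C -addrA lerDl addr_ge0.
have BC' : B' <= C by rewrite /C addrAC lerDr addr_ge0.
have := Hk (fun y => G P n a y 0 j) (A * a.+1%:R ^+ q) (dom P) (tt n) (tt (n - a)%N)
  (fun j => hist P j.+1 n a (tt n)) h Q (@dom_open _ _ _ _ P) _ w0 _ h01 (HA P n a j).
move=> H; apply: le_trans (H _ _ _ _) _.
- by move=> s; exact: Dc.
- rewrite /Q -[X in X <= _]mulr1 ler_pM//.
  by rewrite /C lerDr addr_ge0.
- move=> j' j'N; apply: (le_trans (HB' _ _ _ _ _ _ tr an j'N)).
  by rewrite ler_pM ?exprn_ge0// ler_natX ?leq_maxr.
- apply: (le_trans (HB _ _ _ _ _ tr an)); rewrite ler_wpM2r ?exprn_ge0//.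
    by case/andP: h01 => /ltW.
  by rewrite ler_pM ?exprn_ge0// ler_natX ?leq_maxl.
rewrite /Q exprMn -exprM exprD.
by rewrite le_eqVlt; apply/orP; left; apply/eqP; ring.
Qed.

Lemma triangular_sum (h : R) N (X : nat -> nat -> V) :
  \sum_(m < N) h ^+ m.+1 *: (\sum_(1 <= j < m.+2) X j (m.+1 - j)%N) =
  \sum_(1 <= j < N.+1) h ^+ j *: (\sum_(r < (N - j).+1) h ^+ r *: X j r).
Proof.
elim: N => [|N IH]; first by rewrite big_ord0 big_geq.
rewrite big_ord_recr IH /= [RHS]big_nat_recr//= [\sum_(1 <= j < N.+2) X j _]big_nat_recr//=.
rewrite subnn big_ord1 expr0 scale1r scalerDr addrA; congr (_ + _).
rewrite scaler_sumr -big_split/= big_nat_cond [RHS]big_nat_cond.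
apply: eq_bigr => j /andP[/andP[_ jN] _]; rewrite subSn// [in RHS]big_ord_recr/=.
by rewrite scalerDr scalerA -exprD addnS subnKC.
Qed.

Lemma trajectory_sub (P : losses) h tt n a : trajectory P h tt -> (a <= n)%N ->
  tt (n - a)%N - tt n =
  - \sum_(1 <= s < a.+1) \sum_(1 <= j < K.+1) h ^+ j *: coef P j (n - s)%N (tt (n - s)%N).
Proof.
case=> _ _ ml _; elim: a => [|a IH] an; first by rewrite subn0 subrr big_geq ?oppr0.
rewrite big_nat_recr//= opprD -(IH (ltnW an)).
have := ml (n - a.+1)%N; rewrite -subSn// subSS => ->.
by rewrite [tt _ + _ - tt n]addrAC addrK.
Qed.

Lemma histE (P : losses) m n a x : hist P m.+1 n a x =
  - \sum_(1 <= s < a.+1) \sum_(1 <= j < m.+2)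
     Kpart (coef P j (n - s)%N) (fun j' => hist P j'.+1 n s x) (m.+1 - j) x.
Proof. exact: histSE. Qed.

Lemma ubsmoothV_coef j : (0 < j <= 2 * K)%N ->
  ubsmoothV (2 * K - j) (fun (P : losses) n a => coef P j (n - a)%N).
Proof.
case: j => // j jK i; have [H _] := ubsmooth_coef_hist d beta01 M0 jK.
exact: ubsmooth0_shift (H i).
Qed.

(** In the increment [h ^+ j *: coef j] the prefactor already supplies [j] orders, so for
    [1 <= j <= N] the expansion of lower order [N - j] suffices, and for [j > N] the whole term
    belongs to the remainder. *)
Lemma bigO_backward N : (N < K)%N -> bigO N.+1 (backward N).
Proof.
elim/ltn_ind: N => N IH NK.
pose qs (P : losses) n s x := fun j => hist P j.+1 n s x.
have tail j : (N < j <= K)%N ->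
    bigO N.+1 (fun P h tt n s => h ^+ j *: coef P j (n - s)%N (tt (n - s)%N)).
  move=> /andP[Nj jK]; apply: (@bigO_le (j + 0)%N); first by rewrite addn0.
  apply: bigO_scale; apply: (@bigO_bounded (fun P n s => coef P j (n - s)%N)
    (fun tt n s => tt (n - s)%N) (2 * K - j)).
    apply: ubsmoothV_coef; lia.
  by move=> P h tt n s [].
have main j : (0 < j <= N)%N ->
    bigO N.+1 (fun P h tt n s => h ^+ j *: (coef P j (n - s)%N (tt (n - s)%N) -
      \sum_(r < (N - j).+1) h ^+ r *:
         Kpart (coef P j (n - s)%N) (qs P n s (tt n)) r (tt n))).
  move=> /andP[j0 jN]; have -> : N.+1 = (j + (N - j).+1)%N by lia.
  apply: bigO_scale.
  apply: (@bigO_expansion (N - j) (fun P n s => coef P j (n - s)%N)); first lia.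
    apply: (ubsmoothV_le _ (ubsmoothV_coef _)); lia.
  apply: IH; lia.
have := bigON (bigO_hist_sum (bigOD
  (bigO_sum (index_iota 1 N.+1) (p := fun j => 0 < j <= N)%N _ main)
  (bigO_sum (index_iota N.+1 K.+1) (p := fun j => N < j <= K)%N _ tail))).
apply: eq_bigO => P h tt n a tr an.
(* The history terms, regrouped by [triangular_sum], are exactly the truncated expansions subtracted
   in [main]. *)
have hE : \sum_(m < N) h ^+ m.+1 *: hist P m.+1 n a (tt n) =
  - \sum_(1 <= s < a.+1) \sum_(1 <= j < N.+1) h ^+ j *: (\sum_(r < (N - j).+1)
      h ^+ r *: Kpart (coef P j (n - s)%N) (qs P n s (tt n)) r (tt n)).
  under eq_bigr do rewrite histE scalerN scaler_sumr.
  rewrite sumrN exchange_big/=; congr (- _); apply: eq_bigr => s _.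
  exact: (triangular_sum h N (fun j r =>
    Kpart (coef P j (n - s)%N) (qs P n s (tt n)) r (tt n))).
rewrite /backward (trajectory_sub tr an) hE -opprD; congr (- _).
rewrite -sumrB; apply: eq_bigr => s _.
rewrite [in RHS](@big_cat_nat _ _ _ N.+1)//=; last exact: ltnW.
rewrite [RHS]addrAC -sumrB; congr (_ + _).
  rewrite big_nat_cond [RHS]big_nat_cond; apply: eq_big => j.
    by rewrite andbT ltnS andbb.
  by move=> _; rewrite scalerBr.
rewrite big_nat_cond [RHS]big_nat_cond; apply: eq_bigl => j.
by rewrite andbT ltnS andbb.
Qed.

End Trajectories.

(** * Local defect and global error *)

Section Errors.
Variables (R : realType) (d : nat) (beta : R) (K : nat) (M : R).
Hypothesis beta01 : 0 < beta < 1.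
Hypothesis M0 : 0 <= M.
Hypothesis K0 : (0 < K)%N.
Local Notation V := 'rV[R]_d.
Local Notation losses := (losses d (2 * K) M).
Local Notation coef P := (coef beta (loss P)).
Local Notation hist P := (hist beta (loss P)).

Lemma Ksum00 (G : V -> V) (qs : nat -> V) x : Ksum G qs 0 0 x = G x.
Proof.
rewrite /Ksum (big_pred1 [ffun=> ord0]) => [|k].
  rewrite big_ord1 ffunE fact0 invr1 scale1r enum_ordSl enum_ord0 /=.
  by rewrite ffunE.
rewrite !big_ord1 mul0n eqxx andbT.
have -> : k = [ffun=> ord0] by apply/ffunP => j; rewrite ffunE (ord1 (k j)).
by rewrite /= ffunE !eqxx.
Qed.

(** This merges the two cases of the recursion: at order 0 the expansion of a gradient is the
    gradient itself, and only the term [k = 0] remains apart. *)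
Lemma coefSE (P : losses) r n x : coef P r.+1 n x =
  - (if r == 0%N then grad (loss P n) x else 0)
  - \sum_(1 <= k < n.+1) beta ^+ k *:
      Kpart (grad (loss P (n - k)%N)) (fun j => hist P j.+1 n k x) r x.
Proof.
case: r => [|r]; last by rewrite coefSSE oppr0 add0r.
rewrite coef1E big_ltn// expr0 scale1r subn0 opprD; congr (_ - _).
by apply: eq_bigr => k _; rewrite /Kpart big_ord1 Ksum00.
Qed.

Definition defect (P : losses) (h : R) (tt : nat -> V) n : V :=
  tt n.+1 - tt n +
  h *: \sum_(k < n.+1) beta ^+ k *: grad (loss P (n - k)%N) (tt (n - k)%N).

(** The current gradient cancels exactly; for each past gradient the coefficients subtract its
    expansion at [tt n] up to order [K.-1]. *)
Lemma defectE P h tt n : trajectory beta P h tt ->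
  defect P h tt n = h *: \sum_(1 <= k < n.+1) beta ^+ k *:
    (grad (loss P (n - k)%N) (tt (n - k)%N) - \sum_(r < K) h ^+ r *:
       Kpart (grad (loss P (n - k)%N)) (fun j => hist P j.+1 n k (tt n)) r (tt n)).
Proof.
move=> [_ _ ml _]; rewrite /defect.
have -> : tt n.+1 - tt n = - (h *: grad (loss P n) (tt n)) -
    h *: \sum_(1 <= k < n.+1) beta ^+ k *: \sum_(r < K) h ^+ r *:
       Kpart (grad (loss P (n - k)%N)) (fun j => hist P j.+1 n k (tt n)) r (tt n).
  rewrite ml [tt n + _]addrC addrK big_add1/= big_mkord.
  under [LHS]eq_bigr do rewrite coefSE scalerBr scalerN exprS.
  rewrite sumrB; congr (_ - _).
    rewrite sumrN (bigD1 (Ordinal K0))//= expr0 mulr1 big1 ?addr0// => -[[|r] rK]//= _.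
    by rewrite scaler0.
  under eq_bigr do rewrite scaler_sumr.
  rewrite exchange_big/= scaler_sumr; apply: eq_bigr => k _.
  rewrite !scaler_sumr; apply: eq_bigr => r _.
  by rewrite !scalerA; congr (_ *: _); ring.
rewrite -(big_mkord xpredT (fun k => beta ^+ k *: grad (loss P (n - k)%N) (tt (n - k)%N))).
rewrite big_ltn// expr0 scale1r subn0 scalerDr.
under [in RHS]eq_bigr do rewrite scalerBr.
by rewrite sumrB scalerBr [- _ - _ in LHS]addrC addrA subrK addrC.
Qed.

(** The gradient remainders are of order [h ^+ K] with polynomial weights that the discount absorbs;
    the prefactor [h] gives the last power. *)
Lemma defect_bound : exists2 C1 : R, 0 <= C1 &
  forall P h tt n, trajectory beta P h tt -> `|defect P h tt n| <= C1 * h ^+ K.+1.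
Proof.
have KK : (K.-1 < K)%N by rewrite prednK.
have HL : ubsmoothV K.-1.+1 (fun (P : losses) n a => grad (loss P (n - a))).
  apply: (ubsmoothV_le _ (ubsmoothV_grad M0 _)); lia.
have K2 : (K.-1 < 2 * K)%N by lia.
have [A [q [A0 HA]]] := bigO_expansion beta01 M0 K2 HL (bigO_backward d beta01 M0 KK).
have [B B0 HB] := discounted_sum_bounded q beta01.
exists (A * B) => [|P h tt n tr]; first exact: mulr_ge0.
have h0 : 0 <= h by case: tr => _ /andP[/ltW].
have bk k : 0 <= beta ^+ k by rewrite exprn_ge0// ltW//; case/andP: beta01.
rewrite defectE// normrZ (ger0_norm h0) exprS mulrCA ler_wpM2l//.
rewrite (le_trans (ler_norm_sum _ _ _))//.
apply: (@le_trans _ _ (A * h ^+ K * \sum_(0 <= k < n.+1) beta ^+ k * k.+1%:R ^+ q)).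
  rewrite [X in _ <= _ * X]big_ltn// mulrDr mulr_sumr -[leLHS]add0r lerD//.
    by rewrite !mulr_ge0// exprn_ge0.
  rewrite big_nat_cond [leRHS]big_nat_cond; apply: ler_sum => k /andP[/andP[_ kn] _].
  rewrite normrZ ger0_norm// mulrCA ler_wpM2l//.
  by have := HA P h tt n k tr kn; rewrite prednK// mulrAC.
by rewrite mulrAC ler_wpM2r ?exprn_ge0// ler_wpM2l// big_mkord.
Qed.

Lemma grad_lipschitz (P : losses) n (x y : V) :
  (forall s : R, 0 <= s <= 1 -> dom P (x + s *: (y - x))) ->
  `|grad (loss P n) y - grad (loss P n) x| <= M * d%:R * `|y - x|.
Proof.
move=> Dseg; apply: mx_norm_le => [|i j]; first by rewrite !mulr_ge0.
have b1 : bsmooth 1 (dom P) (fun x => grad (loss P n) x 0 j) M.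
  have K2 : (0 < 2 * K)%N by lia.
  by apply: (bsmooth_le _ (lexx M) (bsmooth_grad P n j K2)); lia.
have := taylor_bound (@dom_open _ _ _ _ P) M0 ler01 b1 Dseg.
rewrite (ord1 i) scale1r [x + _]addrC subrK /tpoly horner_poly big_ord1 mulr1 expr1.
rewrite fact0 divr1 mulr1 mulrA.
suff -> : (grad (loss P n) y - grad (loss P n) x) 0 j
  = grad (loss P n) y 0 j - grad (loss P n) x 0 j by [].
by rewrite !mxE.
Qed.

(* Discrete Gronwall: the error after [n] steps is at most
   [n * delta * (1 + h * Lam) ^+ n], where [delta] bounds one defect. *)
Lemma global_error (T : R) : 0 < T -> exists C2 : R,
  forall (P : losses) h th tt n, trajectory beta P h tt -> is_HB beta (loss P) h th ->
    th 0%N = tt 0%N -> (forall n, dom P (th n)) -> n%:R <= T / h ->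
    `|th n - tt n| <= C2 * h ^+ K.
Proof.
move=> T0; have [C1 C10 HC] := defect_bound.
have [B B0 HB] := discounted_sum_bounded 0 beta01.
(* Lipschitz constant of one gradient times a bound on the sum of the [beta ^+ k]. *)
pose Lam := M * d%:R * B.
have Lam0 : 0 <= Lam by rewrite !mulr_ge0.
(* The factors come from [n h <= T] and [(1 + h Lam)^n <= exp(Lam T)]. *)
exists (T * C1 * expR (Lam * T)) => P h th tt n tr hb th0 Dth nT.
have [Dc /andP[h0 _] _ Dtt] := tr.
have bk k : 0 <= beta ^+ k by rewrite exprn_ge0// ltW//; case/andP: beta01.
have h0' := ltW h0.
pose rho := 1 + h * Lam.
have rho1 : 1 <= rho by rewrite lerDl mulr_ge0.
have rho0 : 0 <= rho by rewrite (le_trans _ rho1).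
pose delta := C1 * h ^+ K.+1.
have delta0 : 0 <= delta by rewrite mulr_ge0// exprn_ge0.
have gron m : `|th m - tt m| <= m%:R * delta * rho ^+ m.
  elim/ltn_ind: m => -[|m] IH; first by rewrite th0 subrr normr0 !mul0r.
  (* The update sees all earlier errors; the majorant is nondecreasing, so its value at [m] bounds
     them all. *)
  have IHm k : (k <= m)%N -> `|th k - tt k| <= m%:R * delta * rho ^+ m.
    move=> km; rewrite (le_trans (IH k _))// ler_pM ?mulr_ge0 ?exprn_ge0//.
      by rewrite ler_wpM2r// ler_nat.
    by rewrite ler_weXn2l.
  have -> : th m.+1 - tt m.+1 = (th m - tt m) - h *: (\sum_(k < m.+1) beta ^+ k *:
      (grad (loss P (m - k)%N) (th (m - k)%N) - grad (loss P (m - k)%N) (tt (m - k)%N)))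
      - defect P h tt m.
    rewrite hb /defect.
    under [in RHS]eq_bigr do rewrite scalerBr.
    rewrite sumrB scalerBr !opprD !opprK !addrA.
    set a := h *: _; set b := h *: _.
    by move: a b => a b; apply/matrixP => i j; rewrite !mxE; ring.
  rewrite (le_trans (ler_normB _ _))// (@le_trans _ _ ((m%:R * delta * rho ^+ m) * rho + delta))//.
    apply: lerD; last exact: HC.
    rewrite (le_trans (ler_normB _ _))// mulrDr mulr1 lerD//; first exact: IHm.
    rewrite normrZ (ger0_norm h0') mulrCA ler_wpM2l//.
    rewrite (le_trans (ler_norm_sum _ _ _))//.
    apply: (@le_trans _ _ (\sum_(k < m.+1) (beta ^+ k * k.+1%:R ^+ 0) *
        (M * d%:R * (m%:R * delta * rho ^+ m)))).
      apply: ler_sum => k _; rewrite normrZ ger0_norm// mulr1 ler_wpM2l//.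
      apply: (le_trans (grad_lipschitz _ _)); first by move=> s; exact: Dc.
      by rewrite ler_wpM2l ?mulr_ge0// IHm// leq_subr.
    rewrite -mulr_suml.
    have -> (e : R) : e * Lam = B * (M * d%:R * e) by rewrite /Lam; ring.
    by rewrite ler_wpM2r// !mulr_ge0// exprn_ge0.
  rewrite -mulrA -exprSr -[m.+1%:R]natr1 !mulrDl lerD// mul1r.
  by rewrite ler_peMr// exprn_ege1.
apply: (le_trans (gron n)).
have nh : n%:R * h <= T by rewrite -ler_pdivlMr.
have rhoE : rho ^+ n <= expR (Lam * T).
  apply: (@le_trans _ _ (expR (h * Lam) ^+ n)).
    by rewrite lerXn2r ?nnegrE ?expR_ge0// expR_ge1Dx.
  by rewrite -expRM_natl ler_expR mulrA mulrC ler_wpM2l.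
rewrite /delta exprS.
have -> : n%:R * (C1 * (h * h ^+ K)) * rho ^+ n = (n%:R * h) * C1 * rho ^+ n * h ^+ K by ring.
rewrite ler_wpM2r ?exprn_ge0// ler_pM ?mulr_ge0 ?exprn_ge0//.
by rewrite ler_wpM2r.
Qed.

End Errors.

(** * From the stated regularity to the error bounds *)

(** [bsmooth] differentiates along coordinate vectors only; their max norm is at most 1, so the
    product of norms in the operator bound is at most 1. *)
Lemma Ck_on_bsmooth (R : realType) (d k : nat) (D : set 'rV[R]_d)
    (f : 'rV[R]_d -> R) (N M : R) :
  N <= M -> 0 <= M -> Ck_on k D f -> derivs_bounded_on k D f N ->
  bsmooth k D f M.
Proof.
move=> NM M0 [df _] bf.
have prod01 us : (forall u : 'rV[R]_d, u \in us -> `|u| <= 1) ->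
    0 <= \prod_(u <- us) `|u| <= 1.
  elim: us => [|u us IH] us1; first by rewrite big_nil ler01 lexx.
  have /andP[p0 p1] : 0 <= \prod_(v <- us) `|v| <= 1.
    by apply: IH => v vus; apply: us1; rewrite inE vus orbT.
  rewrite big_cons.
  by rewrite mulr_ge0//= mulr_ile1// us1// mem_head.
have bnd us x : (size us <= k)%N -> (forall u, u \in us -> `|u| <= 1) -> D x ->
    `|dern f us x| <= M.
  move=> usk /prod01/andP[p0 p1] Dx; apply: (le_trans (bf us usk x Dx)).
  by rewrite (@le_trans _ _ (M * \prod_(u <- us) `|u|))// ?ler_wpM2r// ler_piMr.
suff H m us : (m + size us <= k)%N -> (forall u, u \in us -> `|u| <= 1) ->
    bsmooth m D (dern f us) M.
  by apply: (H k [::]) => //; rewrite addn0.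
elim: m us => [|m IH] us muk us1.
  by split => // x Dx; exact: bnd.
split=> [x Dx|]; first by apply: bnd => //; rewrite (leq_trans _ muk)// leq_addl.
split=> [x Dx|j].
  by apply: df => //; rewrite (leq_trans _ muk)// addSn ltnS leq_addl.
apply: (IH (delta_mx 0 j :: us)); first by rewrite /= addnS -addSn.
by move=> u; rewrite inE => /orP[/eqP ->|/us1//]; exact: mx_norm_delta_le1.
Qed.

Theorem mainTheorem2 (R : realType) (d K : nat) (beta T M : R) :
  (0 < beta < 1) -> (2 <= K)%N -> 0 < T ->
  exists C1 C2 : R,
  forall (D : set 'rV[R]_d) (L : nat -> 'rV[R]_d -> R) (theta0 : 'rV[R]_d),
    open D -> convex_set (D : set (convex_lmodType 'rV[R]_d)) ->
    (forall n, Ck_on (2 * K) D (L n)) ->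
    (forall n, derivs_bounded_on (2 * K) D (L n) M) ->
    D theta0 ->
  forall h : R, 0 < h < 1 / 2 ->
  forall th tt : nat -> 'rV[R]_d,
    th 0%N = theta0 -> tt 0%N = theta0 ->
    is_HB beta L h th -> is_memoryless beta L K h tt ->
    (forall n, D (th n)) -> (forall n, D (tt n)) ->
  forall n : nat, n%:R <= T / h ->
    `|tt n.+1 - tt n + h *: \sum_(k < n.+1) beta ^+ k *: grad (L (n - k)%N) (tt (n - k)%N)|
      <= C1 * h ^+ K.+1 /\
    `|th n - tt n| <= C2 * h ^+ K.
Proof.
move=> b01 K2 T0; pose M' := Num.max M 0.
have M'0 : 0 <= M' by rewrite le_max lexx orbT.
have K0 : (0 < K)%N by exact: ltnW.
(* Both constants are obtained before the domain and the losses are introduced. *)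
have [C1 _ HC1] := @defect_bound R d beta K M' b01 M'0 K0.
have [C2 HC2] := @global_error R d beta K M' b01 M'0 K0 T T0.
exists C1, C2 => D L theta0 oD cD Ck bd Dth0 h h01 th tt th0 tt0 hb ml Dth Dtt n nT.
have bs m : bsmooth (2 * K) D (L m) M'.
  by apply: Ck_on_bsmooth M'0 (Ck m) (bd m); rewrite le_max lexx.
pose P := Losses oD bs.
have tr : trajectory beta P h tt.
  split=> //=; last by case/andP: h01 => -> /= ?; lra.
  move=> x y s Dx Dy /andP[s0 s1].
  have := cD y x (Itv01 s0 s1); rewrite !inE => /(_ Dy Dx).
  suff -> : x + s *: (y - x) = s *: y + (1 - s) *: x by [].
  by rewrite scalerBr scalerBl scale1r addrA addrAC addrC [x + _]addrC.
split; first exact: HC1 tr.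
by apply: (HC2 P h th tt n) => //=; rewrite th0 tt0.
Qed.
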